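(* Let $\omega>0$, $\sigma>0$, $\lambda>0$, let $z\in\mathcal{B}_\omega$ and $f_\sigma=\phi_\sigma * z$. Let $F_1(u)=\int_{\mathbb{R}}|u'|+\lambda\|u-f_\sigma\|_{L^2(\mathbb{R})}^2$. The following hold. (1) Let $\phi_\sigma\in\mathcal{K}$. Then $u\equiv 0$ is the unique minimiser of $F_1$ over $BV(\mathbb{R})$ if and only if $\|f_\sigma\|_*\le \frac{1}{2\lambda}$. (2) Let $\phi_\sigma=\hat\phi_\sigma$ and $z\in\mathcal{B}_\omega$. If $\sigma\le\omega$ and $\frac23\sigma+\frac2\lambda<\omega$, then $u=z$ is the unique minimiser of $F_1$ over $\mathcal{B}$.
   Context: Functions are identified when equal almost everywhere, and $\int_{\mathbb{R}}|u'|$ denotes the total variation of $u$ on $\mathbb{R}$. Bar codes: $\mathcal{B}=\{u\in BV(\mathbb{R};\{0,1\}): u=0 \text{ a.e. in } \mathbb{R}\setminus[0,1]\}$. Up to null sets, for $u\in\mathcal{B}$ the set $\{x\in[0,1]:u(x)=1\}$ is a finite disjoint union of non-empty (nondegenerate) intervals $b_i$ (bars), and $\{x\in[0,1]:u(x)=0\}$ is a finite disjoint union of non-empty intervals $w_i$ (white spaces). For $\omega>0$, $\mathcal{B}_\omega$ is the set of $u\in\mathcal{B}$ all of whose bars and white spaces satisfy $|b_i|\ge\omega$, $|w_i|\ge\omega$. Kernels: $\mathcal{K}$ is the class of $\phi_\sigma\in L^1(\mathbb{R})$, with parameter $\sigma>0$ (the subscript), of the form $\phi_\sigma(x)=p(-x,\sigma)\chi_{[-\sigma,0]}(x)+p(x,\sigma)\chi_{[0,\sigma]}(x)$,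 where $p(\cdot,\sigma)$ is non-negative and monotonically decreasing on $[0,\sigma]$ with $\int_0^\sigma p(x,\sigma)\,dx=\frac12$. The hat function is $\hat\phi_\sigma(x)=\frac1\sigma\left(1-\frac{|x|}{\sigma}\right)$ for $|x|<\sigma$ and $\hat\phi_\sigma(x)=0$ for $|x|\ge\sigma$. Dual norm: $\|f\|_*=\sup\left\{\left|\int_{\mathbb{R}}fv\right| : v\in L^1(\mathbb{R}),\ \int_{\mathbb{R}}|v'|\le 1\right\}$. *)

(* Defs.v *)
From HB Require Import structures.
From mathcomp Require Import all_boot all_order all_algebra.
From mathcomp Require Import all_classical all_reals all_analysis.

Set Implicit Arguments.
Unset Strict Implicit.
Unset Printing Implicit Defensive.

Import Order.TTheory GRing.Theory Num.Theory.
Import numFieldNormedType.Exports.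

Local Open Scope classical_set_scope.
Local Open Scope ring_scope.

(* Classes modulo a.e. equality are represented by Borel functions R -> R (every
   Lebesgue measurable function agrees a.e. with a Borel one): the predicates and
   functionals below do not distinguish Borel functions that agree a.e., and
   uniqueness of a minimiser is uniqueness modulo a.e. equality. *)

Section BarCodes.
Context {R : realType}.

Local Notation mu := (@lebesgue_measure R).

Definition L1 : set (R -> R) := [set u | mu.-integrable [set: R] (EFin \o u)].

Definition TV_test : set (R -> R) :=
  [set phi : R -> R | [/\ forall x, derivable phi x 1,
                 continuous phi^`()%classic,
                 compact (closure [set x | phi x != 0]) &
                 forall x, `|phi x| <= 1]].

(* The total variation of the distributional derivative, meant for u in L1;
   the library's [total_variation] is pointwise variation on [a, b], which is
   not invariant under a.e. equality. *)
Definition TV (u : R -> R) : \bar R :=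
  ereal_sup [set (\int[mu]_x (u x * phi^`()%classic x)%:E)%E | phi in TV_test].

Definition BV : set (R -> R) := L1 `&` [set u | (TV u < +oo)%E].

Definition barcode : set (R -> R) :=
  BV `&` [set u | {ae mu, forall x, u x = 0 \/ u x = 1} /\
                  {ae mu, forall x, ~ (`[0, 1]%classic x) -> u x = 0}].

(* The points 0 = t 0 < ... < t n = 1 cut [0, 1] into intervals on which u is
   alternately 0 and 1 a.e., the first value being b. Since the values
   alternate, n, b and t 0, ..., t n are determined by u, and the n intervals
   are exactly the bars and the white spaces of u. *)
Definition bars_and_spaces (u : R -> R) (n : nat) (b : bool) (t : nat -> R) :=
  [/\ (0 < n)%N, t 0%N = 0, t n = 1,
      forall i, (i < n)%N -> t i < t i.+1 &
      forall i, (i < n)%N ->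
        {ae mu, forall x, `]t i, t i.+1[%classic x -> u x = (b (+) odd i)%:R}].

Definition barcode_width (omega : R) : set (R -> R) :=
  barcode `&` [set u | exists n b t, bars_and_spaces u n b t /\
                         forall i, (i < n)%N -> omega <= t i.+1 - t i].

Definition blur_kernel (sigma : R) : set (R -> R) :=
  L1 `&` [set phi | exists p : R -> R,
    [/\ forall x, x \in `[0, sigma] -> 0 <= p x,
        {in `[0, sigma] &, nonincreasing_fun p},
        (\int[mu]_(x in `[0%R, sigma]%classic) (p x)%:E = (2^-1)%:E)%E &
        phi = (fun x => p (- x) * \1_(`[- sigma, 0]%classic) x
                        + p x * \1_(`[0, sigma]%classic) x) %[ae mu]]].

Definition hat (sigma x : R) : R :=
  if `|x| < sigma then sigma^-1 * (1 - `|x| / sigma) else 0.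

Definition convolution (f g : R -> R) (x : R) : R :=
  \int[mu]_y (f (x - y) * g y).

Definition dual_norm (f : R -> R) : \bar R :=
  ereal_sup [set (`| \int[mu]_x (f x * v x)%:E |)%E
            | v in [set v | L1 v /\ (TV v <= 1)%E]].

Definition F1 (lambda : R) (f u : R -> R) : \bar R :=
  (TV u + lambda%:E * 'N[mu]_2%:E [EFin \o (u \- f)%R] ^+ 2)%E.

Definition unique_minimiser (F : (R -> R) -> \bar R) (A : set (R -> R))
    (u0 : R -> R) : Prop :=
  [/\ A u0,
      forall v, A v -> (F u0 <= F v)%E &
      forall u, A u -> (forall v, A v -> (F u <= F v)%E) -> u = u0 %[ae mu]].

End BarCodes.

(* Main.v *)
Require Import Defs.
From HB Require Import structures.
From mathcomp Require Import all_boot all_order all_algebra.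
From mathcomp Require Import all_classical all_reals all_analysis.
From mathcomp Require Import measurable_realfun lra zify.

(* Part (1). Expanding the square, F_1(u) - F_1(0) = int|u'| - 2 lambda int f u
   + lambda int u^2. If ||f||_* <= 1/(2 lambda) the first two terms have a
   nonnegative sum; conversely, testing minimality of 0 against t v and letting
   t -> 0 gives 2 lambda |int f v| <= int|v'|. This needs v in L^2, which holds
   because a function of bounded variation is essentially bounded: its averages
   against narrow hat functions stay within int|v'| of one fixed average, and
   converge to v at Lebesgue points.

   Part (2). Let e_0 < ... < e_(N-1) be the jumps of z and Theta the primitive of
   the hat function, so that f = sum_j (-1)^j Theta(x - e_j). On {0,1}-valued u the
   fidelity term is affine, with slope lambda (1 - 2 f), hence z can be calibrated:
   it suffices to find phi of class C^1 with |phi| <= 1, phi(e_j) = -(-1)^j and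
   phi' + lambda (1 - 2 f) of the strict sign that penalises u <> z. Between
   consecutive jumps phi' is a multiple of 2 f - 1, which vanishes at both of them
   since sigma <= omega; as phi has to change by 2 there while |int (2 f - 1)| is the
   width minus 2 sigma / 3, the factor is smaller than lambda exactly when
   2/3 sigma + 2/lambda is smaller than that width. *)

Set Implicit Arguments.
Unset Strict Implicit.
Unset Printing Implicit Defensive.

Import Order.TTheory GRing.Theory Num.Theory.
Import numFieldNormedType.Exports.

Local Open Scope classical_set_scope.
Local Open Scope ring_scope.

(* Instance resolution does not find the filter structure of [ae mu]. *)
#[local] Instance ae_lebesgue_filter (R : realType) :
  Filter (nbhs (almost_everywhere (@lebesgue_measure R))).
Proof. exact: (ae_filter_ringOfSetsType lebesgue_measure). Qed.

(** * Integrable and essentially bounded functions on the line *)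

Section IntegrableFunctions.
Context {R : realType}.
Local Notation mu := (@lebesgue_measure R).
Implicit Types u v w : R -> R.

Definition ess_bounded u := exists M, {ae mu, forall x, `|u x| <= M}.

Lemma L1_measurable u : L1 u -> measurable_fun [set: R] u.
Proof. by move=> /measurable_int/measurable_EFinP. Qed.

Lemma L1D u v : L1 u -> L1 v -> L1 (fun x => u x + v x).
Proof. by move=> hu hv; exact: (integrableD measurableT hu hv). Qed.

Lemma L1Z c u : L1 u -> L1 (fun x => c * u x).
Proof. by move=> hu; exact: (integrableZl measurableT c hu). Qed.

Lemma L1B u v : L1 u -> L1 v -> L1 (fun x => u x - v x).
Proof. by move=> hu hv; exact: (integrableB measurableT hu hv). Qed.

Lemma L1_sum n (h : nat -> R -> R) :
  (forall i, (i < n)%N -> L1 (h i)) -> L1 (fun x => \sum_(i < n) h i x).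
Proof.
elim: n => [|n IHn] hh.
  rewrite (_ : (fun x => _) = cst 0); first exact: integrable0.
  by apply/funext => x; rewrite big_ord0.
rewrite (_ : (fun x => _) = (fun x => \sum_(i < n) h i x + h n x)).
  by apply: L1D; [apply: IHn => i /ltnW; apply: hh|apply: hh].
by apply/funext => x; rewrite big_ord_recr.
Qed.

Lemma L1_ae_le u v : L1 v -> measurable_fun [set: R] u ->
  {ae mu, forall x, `|u x| <= v x} -> L1 u.
Proof.
move=> hv mu_ uv.
apply/integrableP; split; first exact/measurable_EFinP.
have mv := L1_measurable hv.
have /integrableP[_] := hv; apply: le_lt_trans.
apply: ae_ge0_le_integral => //=.
- by apply/measurable_EFinP; apply: measurableT_comp.
- by apply/measurable_EFinP; apply: measurableT_comp.
- by apply: filterS uv => x uvx _; rewrite lee_fin (le_trans uvx)// ler_norm.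
Qed.

Lemma L1M u v : L1 u -> measurable_fun [set: R] v -> ess_bounded v ->
  L1 (fun x => u x * v x).
Proof.
move=> hu mv [M vM]; have mu_ := L1_measurable hu.
apply: (@L1_ae_le _ (fun x => M * `|u x|)).
- by apply: L1Z; exact: (integrable_norm hu).
- exact: measurable_funM.
- by apply: filterS vM => x xM; rewrite normrM mulrC ler_wpM2r.
Qed.

Lemma L1_sqr u : L1 u -> ess_bounded u -> L1 (fun x => u x ^+ 2).
Proof.
by move=> hu bu; under eq_fun do rewrite expr2; apply: L1M => //; exact: L1_measurable.
Qed.

Lemma ess_boundedD u v : ess_bounded u -> ess_bounded v ->
  ess_bounded (fun x => u x + v x).
Proof.
move=> [M uM] [N vN]; exists (M + N).
by apply: filterS2 uM vN => x xM xN; rewrite (le_trans (ler_normD _ _))// lerD.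
Qed.

Lemma ess_boundedZ c u : ess_bounded u -> ess_bounded (fun x => c * u x).
Proof.
move=> [M uM]; exists (`|c| * M).
by apply: filterS uM => x xM; rewrite normrM ler_wpM2l.
Qed.

Lemma ess_boundedB u v : ess_bounded u -> ess_bounded v ->
  ess_bounded (fun x => u x - v x).
Proof.
move=> bu /(ess_boundedZ (-1)) bv; have := ess_boundedD bu bv.
by under eq_fun do rewrite mulN1r.
Qed.

Lemma EFin_Rintegral u : L1 u ->
  (\int[mu]_x (u x)%:E)%E = (\int[mu]_x u x)%:E.
Proof. by move=> hu; rewrite /Rintegral fineK//; exact: integrable_fin_num. Qed.

Lemma ae_eq_Rintegral u v : L1 u -> measurable_fun [set: R] v ->
  {ae mu, forall x, u x = v x} -> \int[mu]_x u x = \int[mu]_x v x.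
Proof.
move=> hu mv uv; congr fine; apply: ae_eq_integral => //.
- exact: measurable_int hu.
- exact/measurable_EFinP.
- by apply: filterS uv => x -> _.
Qed.

(** Serves both uniqueness claims: a gap between energies dominates the integral of a nonnegative
    function, so a second minimiser makes that function vanish a.e. *)
Lemma ae_ge0_Rintegral_le0 u : L1 u -> {ae mu, forall x, 0 <= u x} ->
  \int[mu]_x u x <= 0 -> {ae mu, forall x, u x = 0}.
Proof.
move=> hu u0 iu.
have mu_ := L1_measurable hu.
have : (\int[mu]_x `|(EFin \o u) x| = 0)%E.
  have -> : (\int[mu]_x `|(EFin \o u) x| = \int[mu]_x (u x)%:E)%E.
    apply: ae_eq_integral => //.
    - by do 2 apply: measurableT_comp => //.
    - exact/measurable_EFinP.
    - by apply: filterS u0 => x ux _ /=; rewrite ger0_norm.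
  rewrite EFin_Rintegral//; congr EFin; apply/eqP; rewrite eq_le iu/=.
  rewrite (@ae_eq_Rintegral _ (fun x => `|u x|)).
  - exact: Rintegral_ge0.
  - exact: hu.
  - exact: measurableT_comp.
  - by apply: filterS u0 => x ux; rewrite ger0_norm.
move/ae_eq_integral_abs => /(_ measurableT); rewrite measurable_EFinP => /(_ mu_).
by apply: filterS => x /(_ I) [].
Qed.

Lemma ae_le_Rintegral u v : L1 u -> L1 v -> {ae mu, forall x, u x <= v x} ->
  \int[mu]_x u x <= \int[mu]_x v x.
Proof.
move=> hu hv uv; rewrite -subr_ge0 -RintegralB//.
rewrite (@ae_eq_Rintegral _ (fun x => `|v x - u x|)).
- exact: Rintegral_ge0.
- exact: L1B.
- apply: measurableT_comp => //; apply: measurable_funB; exact: L1_measurable.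
- by apply: filterS uv => x uvx; rewrite ger0_norm// subr_ge0.
Qed.

Lemma Rintegral_sum n (h : nat -> R -> R) :
  (forall i, (i < n)%N -> L1 (h i)) ->
  \int[mu]_x (\sum_(i < n) h i x) = \sum_(i < n) \int[mu]_x h i x.
Proof.
elim: n => [|n IHn] hh.
  by rewrite big_ord0; under eq_Rintegral do rewrite big_ord0; rewrite Rintegral_cst//= mul0r.
under eq_Rintegral do rewrite big_ord_recr/=.
have hn i : (i < n)%N -> L1 (h i) by move=> /ltnW; exact: hh.
rewrite RintegralD//; [|exact: L1_sum|exact: hh].
by rewrite IHn// big_ord_recr.
Qed.

Lemma sqr_L2norm u : L1 u -> ess_bounded u ->
  ('N[mu]_2%:E [EFin \o u] ^+ 2 = (\int[mu]_x (u x ^+ 2))%:E)%E.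
Proof.
move=> hu bu; rewrite -EFin_Rintegral; last exact: L1_sqr.
have sqrE (x : \bar R) : (0 <= x -> x ^+ 2 = x `^ 2)%E.
  move=> x0; rewrite (_ : 2 = 1 + 1)%R// poweRD ?poweRe1//.
  by apply: add_neq0_poweRD_def; apply: lt0r_neq0; lra.
rewrite sqrE ?Lnorm_ge0//.
rewrite poweR_Lnorm//; apply: eq_integral => x _ /=.
by rewrite powR_mulrn// real_normK// num_real.
Qed.

Lemma F1E lambda f u : L1 u -> ess_bounded u -> L1 f -> ess_bounded f ->
  F1 lambda f u = (TV u + (lambda * \int[mu]_x ((u x - f x) ^+ 2))%:E)%E.
Proof.
move=> hu bu hf bf; rewrite /F1 sqr_L2norm ?EFinM//; first exact: L1B.
exact: ess_boundedB.
Qed.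

End IntegrableFunctions.

(** * The hat function and its antiderivatives *)

Section Ramp.
Context {R : realType}.
Local Notation mu := (@lebesgue_measure R).
Implicit Types x y r c : R.

Definition signed_square x : R := x * `|x| / 2.
(** This is [|x|^3 / 6]. *)
Definition abs_cube x : R := x * signed_square x / 3.

(* The C^1 step whose derivative is the hat function: a second difference of
   an antiderivative of |x|. *)
Definition ramp r x : R :=
  1 / 2 + (signed_square (x + r) - 2 * signed_square x + signed_square (x - r))
          / (2 * r ^+ 2).

(** A smoothed positive part: 0 to the left of [- r] and [x] to the right of [r]. *)
Definition ramp_primitive r x : R :=
  x / 2 + (abs_cube (x + r) - 2 * abs_cube x + abs_cube (x - r)) / (2 * r ^+ 2).

Lemma is_derive_comp_shift (f : R -> R) c x d :
  is_derive (x + c) 1 f d -> is_derive x 1 (fun y => f (y + c)) d.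
Proof.
move=> hf; have h : is_derive x 1 (fun y => y + c) 1.
  by have := is_deriveD (is_derive_id x 1) (is_derive_cst c x 1); rewrite addr0.
by have := @is_derive1_comp _ f _ x _ _ hf h; rewrite mulr1.
Qed.

Lemma is_derive_comp_reflect (f : R -> R) c x d :
  is_derive (c - x) 1 f d -> is_derive x 1 (fun y => f (c - y)) (- d).
Proof.
move=> hf; have h : is_derive x 1 (fun y => c - y) (-1).
  by have := is_deriveB (is_derive_cst c x 1) (is_derive_id x 1); rewrite sub0r.
by have := @is_derive1_comp _ f _ x _ _ hf h; rewrite mulrN1.
Qed.

Lemma is_derive_signed_square x : is_derive x 1 signed_square `|x|.
Proof.
have cvgq : h^-1 *: (signed_square (h *: 1 + x) - signed_square x) @[h --> 0^'] --> `|x|.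
  apply/cvgrPdist_le => /= e e0.
  near=> h.
  have h0 : h != 0 by near: h; exact: nbhs_dnbhs_neq.
  have he : `|h| <= e.
    by near: h; exact: dnbhs0_le.
  rewrite /signed_square [h *: 1]mulr1 -[_ *: _]/(_ * _).
  apply: (le_trans _ he).
  (* Multiplied by [|h|], the error bound becomes an inequality with [h ^+ 2] that is polynomial for
     each choice of the signs of [x] and [x + h]; the kink at 0 needs no separate treatment. *)
  rewrite -(ler_pM2l (x := `|h|)) ?normr_gt0// -normrM mulrBr mulrA mulfV// mul1r.
  rewrite -[X in _ <= X]expr2 -normrX (ger0_norm (sqr_ge0 h)).
  rewrite ler_norml; apply/andP.
  case: (ger0P (h + x)) => hx; case: (ger0P x) => x0; split; nra.
have dq : derivable signed_square x 1 by apply/cvg_ex; exists `|x|.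
by apply: DeriveDef => //; apply/cvg_lim.
Unshelve. all: by end_near. Qed.

Lemma is_derive_abs_cube x : is_derive x 1 abs_cube (signed_square x).
Proof.
have h := is_derive_signed_square x.
have h2 : is_derive x 1 (3^-1 *: (id * signed_square))
   (3^-1 *: (id x *: `|x| + signed_square x *: 1)) by exact: is_deriveZ.
rewrite (_ : abs_cube = 3^-1 *: (id * signed_square)); last first.
  by apply/funext => y; rewrite /abs_cube/= mulrC.
rewrite [X in is_derive _ _ _ X](_ : _ = 3^-1 *: (id x *: `|x| + signed_square x *: 1))//.
rewrite /signed_square /GRing.scale/=; lra.
Qed.

(** For [|x| < r] the signs of [x + r] and [x - r] are known; otherwise the three arguments share
    one sign, and the second difference of a linear function is 0. *)
Lemma hatE r x : 0 < r ->
  (`|x + r| - 2 * `|x| + `|x - r|) / (2 * r ^+ 2) = hat r x.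
Proof.
move=> r0; rewrite /hat; have r20 : 2 * r ^+ 2 != 0 by rewrite mulf_neq0// ?expf_neq0// gt_eqF.
have [xr|xr] := ltP `|x| r; apply: (canLR (mulfK r20)).
  have -> : r^-1 * (1 - `|x| / r) * (2 * r ^+ 2) = 2 * (r - `|x|).
    have e : r^-1 * r = 1 by rewrite mulVf// gt_eqF.
    have e2 : r^-1 * r ^+ 2 = r by rewrite expr2 mulrA e mul1r.
    have -> : r^-1 * (1 - `|x| / r) * (2 * r ^+ 2) =
       2 * (r^-1 * r ^+ 2 - `|x| * (r^-1 * (r^-1 * r ^+ 2))) by lra.
    by rewrite e2 e mulr1.
  move: xr; rewrite ltr_norml => /andP[x1 x2].
  rewrite ger0_norm; last lra. rewrite (ler0_norm (x:=x - r)); last lra. lra.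
rewrite mul0r; move: xr; rewrite ler_normr => /orP[] xr.
  by rewrite !ger0_norm; lra.
by rewrite !ler0_norm; lra.
Qed.

Lemma is_derive_ramp r x : 0 < r -> is_derive x 1 (ramp r) (hat r x).
Proof.
move=> r0; rewrite -hatE//.
have h1 := is_derive_comp_shift (is_derive_signed_square (x + r)).
have h2 := is_derive_signed_square x.
have h3 := is_derive_comp_shift (is_derive_signed_square (x - r)).
rewrite (_ : ramp r = cst (1/2) + (2 * r ^+ 2)^-1 *: ((fun y => signed_square (y + r))
   - 2 *: signed_square + (fun y => signed_square (y - r)))); last first.
  by apply/funext => y; rewrite /ramp !fctE /GRing.scale/= [in RHS](mulrC _^-1).
have h0 : is_derive x 1 (cst (1 / 2) : R -> R) 0 by exact: is_derive_cst.
have := is_deriveD h0 (is_deriveZ (2 * r ^+ 2)^-1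
  (is_deriveD (is_deriveB h1 (is_deriveZ (2 : R) h2)) h3)).
by rewrite add0r /GRing.scale/= (mulrC _^-1).
Qed.

Lemma is_derive_ramp_primitive r x : is_derive x 1 (ramp_primitive r) (ramp r x).
Proof.
have h1 := is_derive_comp_shift (is_derive_abs_cube (x + r)).
have h2 := is_derive_abs_cube x.
have h3 := is_derive_comp_shift (is_derive_abs_cube (x - r)).
rewrite (_ : ramp_primitive r = 2^-1 *: id + (2 * r ^+ 2)^-1 *: ((fun y => abs_cube (y + r))
   - 2 *: abs_cube + (fun y => abs_cube (y - r)))); last first.
  by apply/funext => y; rewrite /ramp_primitive !fctE /GRing.scale/= !(mulrC _^-1).
have := is_deriveD (is_deriveZ (2^-1 : R) (is_derive_id (x : R) 1)) (is_deriveZ (2 * r ^+ 2)^-1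
  (is_deriveD (is_deriveB h1 (is_deriveZ (2 : R) h2)) h3)).
by rewrite /GRing.scale/= !(mulrC _^-1).
Qed.

End Ramp.

(** * Values and bounds of the ramp and the hat *)

Section RampValues.
Context {R : realType}.
Implicit Types x y r c : R.

Lemma rampN r x : ramp r (- x) = 1 - ramp r x.
Proof.
rewrite /ramp /signed_square normrN.
have -> : `|- x + r| = `|x - r| by rewrite -normrN opprD opprK.
have -> : `|- x - r| = `|x + r| by rewrite -normrN opprD !opprK.
lra.
Qed.

Lemma ramp0 r : ramp r 0 = 1 / 2.
Proof. by have := rampN r 0; rewrite oppr0; lra. Qed.

(** For [x >= 0] only [x - r] can change sign, which leaves one quadratic piece. With [rampN] for
    negative arguments, the bounds on [ramp] below come from this formula. *)
Lemma ramp_ge0 r x : 0 < r -> 0 <= x ->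
  ramp r x = 1 - Num.max 0 (r - x) ^+ 2 / (2 * r ^+ 2).
Proof.
move=> r0 x0; have r20 : 2 * r ^+ 2 != 0 by rewrite mulf_neq0// ?expf_neq0// gt_eqF.
suff : signed_square (x + r) - 2 * signed_square x + signed_square (x - r) =
    1 / 2 * (2 * r ^+ 2) - Num.max 0 (r - x) ^+ 2.
  by move=> e; rewrite /ramp e mulrBl mulfK//; lra.
rewrite /signed_square (ger0_norm x0) (ger0_norm (_ : 0 <= x + r)); last lra.
by case: (lerP 0 (r - x)) => rx; [rewrite ler0_norm; last lra|
  rewrite ger0_norm; last lra]; lra.
Qed.

Lemma ramp_ge r x : 0 < r -> r <= x -> ramp r x = 1.
Proof.
move=> r0 rx; rewrite ramp_ge0//; last lra.
by rewrite max_l ?expr0n/= ?mul0r ?subr0//; lra.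
Qed.

Lemma ramp_le r x : 0 < r -> x <= - r -> ramp r x = 0.
Proof. by move=> r0 rx; rewrite -(opprK x) rampN ramp_ge ?subrr//; lra. Qed.

Lemma ramp_ge_half r x : 0 < r -> 0 <= x -> 1 / 2 <= ramp r x <= 1.
Proof.
move=> r0 x0; rewrite ramp_ge0//.
have r20 : 0 < 2 * r ^+ 2 by rewrite mulr_gt0// exprn_gt0.
have [m0 mr] : 0 <= Num.max 0 (r - x) /\ Num.max 0 (r - x) <= r.
  by case: (lerP 0 (r - x)); lra.
have : 0 <= Num.max 0 (r - x) ^+ 2 / (2 * r ^+ 2) <= 1 / 2.
  apply/andP; split; first by rewrite divr_ge0// ?sqr_ge0// ltW.
  by rewrite ler_pdivrMr//; nra.
lra.
Qed.

Lemma ramp_bounds r x : 0 < r -> 0 <= ramp r x <= 1.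
Proof.
move=> r0; have [x0|x0] := leP 0 x; first by have := ramp_ge_half r0 x0; lra.
have : 0 <= - x by lra.
by move=> /(ramp_ge_half r0); rewrite rampN; lra.
Qed.

Lemma ramp_lt_half r x : 0 < r -> x < 0 -> ramp r x < 1 / 2.
Proof.
move=> r0 x0; have {x0} x0 : 0 < - x by lra.
suff : 1 / 2 < ramp r (- x) by rewrite rampN; lra.
move: (- x) x0 => {}x x0; rewrite ramp_ge0//; last lra.
have r20 : 0 < 2 * r ^+ 2 by rewrite mulr_gt0// exprn_gt0.
have [m0 mr] : 0 <= Num.max 0 (r - x) /\ Num.max 0 (r - x) < r.
  by case: (lerP 0 (r - x)); lra.
have : Num.max 0 (r - x) ^+ 2 / (2 * r ^+ 2) < 1 / 2 by rewrite ltr_pdivrMr//; nra.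
lra.
Qed.

(** The deficits [a = max 0 (r - x)] and [b = max 0 (r - y)] are below [r], and [a + b <= r] when
    both are positive, so [a ^+ 2 + b ^+ 2 < r ^+ 2]. This keeps the blurred signal strictly on one
    side of 1/2 between two jumps. *)
Lemma rampD_gt r x y : 0 < r -> 0 < x -> 0 < y -> r <= x + y ->
  3 / 2 < ramp r x + ramp r y.
Proof.
move=> r0 x0 y0 rxy; rewrite !ramp_ge0//; [|lra|lra].
have r20 : 0 < 2 * r ^+ 2 by rewrite mulr_gt0// exprn_gt0.
have : (Num.max 0 (r - x) ^+ 2 + Num.max 0 (r - y) ^+ 2) / (2 * r ^+ 2) < 1 / 2.
  rewrite ltr_pdivrMr//.
  by case: (lerP 0 (r - x)) => ?; case: (lerP 0 (r - y)) => ?; nra.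
rewrite mulrDl; lra.
Qed.

(** Four times this value is the [2 / 3 * sigma] of the theorem. *)
Lemma ramp_primitive0 r : 0 < r -> ramp_primitive r 0 = r / 6.
Proof.
move=> r0; rewrite /ramp_primitive /abs_cube /signed_square.
rewrite add0r sub0r normrN normr0 (gtr0_norm r0).
have e : r * r^-1 = 1 by rewrite mulfV// gt_eqF.
rewrite invfM -exprVn.
transitivity (r * (r * r^-1) * (r * r^-1) / 6); first by lra.
by rewrite e !mulr1.
Qed.

Lemma ramp_primitive_ge r x : 0 < r -> r <= x -> ramp_primitive r x = x.
Proof.
move=> r0 rx; rewrite /ramp_primitive /abs_cube /signed_square.
rewrite !ger0_norm; [|lra|lra|lra].
have e : r * r^-1 = 1 by rewrite mulfV// gt_eqF.
rewrite invfM -exprVn.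
transitivity (x / 2 + x * (r * r^-1) * (r * r^-1) / 2); first by lra.
by rewrite e !mulr1; lra.
Qed.

Lemma hat_bounds r x : 0 < r -> 0 <= hat r x <= r^-1.
Proof.
move=> r0; have ri : 0 < r^-1 by rewrite invr_gt0.
rewrite /hat; case: ifP => [xr|_]; last by rewrite lexx ltW.
have : 0 <= `|x| / r <= 1.
  by rewrite divr_ge0// ?(ltW r0)//= ler_pdivrMr// mul1r ltW.
by move=> h; nra.
Qed.

Lemma hat_eq0 r x : r <= `|x| -> hat r x = 0.
Proof. by move=> h; rewrite /hat ltNge h. Qed.

Lemma continuous_hat r : 0 < r -> continuous (hat r).
Proof.
move=> r0; rewrite (_ : hat r =
  (fun x => (`|x + r| - 2 * `|x| + `|x - r|) / (2 * r ^+ 2))); last first.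
  by apply/funext => x; rewrite hatE.
move=> x; apply: cvgM; last exact: cvg_cst.
apply: cvgD; first apply: cvgB.
- by apply: cvg_norm; apply: cvgD; [exact: cvg_id|exact: cvg_cst].
- by apply: cvgM; [exact: cvg_cst|apply: cvg_norm; exact: cvg_id].
- by apply: cvg_norm; apply: cvgB; [exact: cvg_id|exact: cvg_cst].
Qed.

End RampValues.

(** * Test functions and total variation *)

Section TestFunctions.
Context {R : realType}.
Local Notation mu := (@lebesgue_measure R).
Implicit Types (x y r c A : R) (u v f g phi : R -> R).

Definition vanishes_outside A g := forall x, A < `|x| -> g x = 0.

Lemma vanishes_outsideW A B g : A <= B -> vanishes_outside A g ->
  vanishes_outside B g.
Proof. by move=> AB h x Bx; apply: h; exact: le_lt_trans Bx. Qed.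

Lemma compact_support_bounded A g : continuous g -> vanishes_outside A g ->
  exists M, forall x, `|g x| <= M.
Proof.
move=> cg g0; have [A0|A0] := leP 0 A; last first.
  by exists 0 => x; rewrite g0 ?normr0// (lt_le_trans A0).
have cng : {within `[- A, A], continuous (fun x => `|g x|)}.
  by apply: continuous_subspaceT => x; apply: cvg_norm; exact: cg.
have [|c _ hc] := EVT_max _ cng; first lra.
exists `|g c| => x; have [xA|xA] := leP `|x| A; last by rewrite (g0 x)// normr0.
by apply: hc; rewrite in_itv/= -ler_norml.
Qed.

Lemma compact_support_L1 A g : continuous g -> vanishes_outside A g -> L1 g.
Proof.
move=> cg g0.
have /integrable_mkcond : mu.-integrable `[- A, A] (EFin \o g).
  apply: continuous_compact_integrable; first exact: segment_compact.
  exact: continuous_subspaceT.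
move=> /(_ (measurable_itv _)); congr (mu.-integrable setT _).
apply/funext => x; rewrite patchE; case: ifPn => // /negP xA.
rewrite /= g0// ltNge; apply/negP => h; apply: xA.
by rewrite inE/= in_itv/= -ler_norml.
Qed.

Lemma derive_vanishes_outside A phi g : (forall x, is_derive x 1 phi (g x)) ->
  vanishes_outside A phi -> vanishes_outside A g.
Proof.
move=> dphi phi0 x Ax.
have h : is_derive x 1 (cst 0 : R -> R) (g x).
  apply: (near_eq_is_derive _ (dphi x)).
  have oA : open [set y : R | A < `|y|].
    by apply: (@open_comp _ _ (fun y : R => `|y|) [set y | A < y]);
      [move=> y _; exact: norm_continuous|exact: open_gt].
  by near=> y; apply: phi0; near: y; exact: (open_nbhs_nbhs (conj oA Ax)).
by have := @derive_val _ _ _ _ _ _ _ h; rewrite derive_cst.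
Unshelve. all: by end_near. Qed.

Lemma is_derive_TV_test A phi g : (forall x, is_derive x 1 phi (g x)) ->
  continuous g -> vanishes_outside A phi -> (forall x, `|phi x| <= 1) ->
  TV_test phi /\ phi^`()%classic = g.
Proof.
move=> dphi cg phi0 phi1.
have dE : phi^`()%classic = g.
  by apply/funext => x; rewrite derive1E; exact: derive_val.
split => //; split => //; first by rewrite dE.
apply: (subclosed_compact _ (@segment_compact _ (- A) A)).
  exact: closed_closure.
apply: (@subset_trans _ (closure `[- A, A])).
  apply: closure_subset => x /= /eqP hx; rewrite in_itv/= -ler_norml leNgt.
  by apply/negP => Ax; apply: hx; exact: phi0.
by rewrite -(closure_id _).1//; exact: interval_closed.
Qed.

(** The entry point for explicit test functions: differences of ramps, rescaled test functions and
    the calibration all pass through it. *)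
Lemma le_TV A u phi g : L1 u -> (forall x, is_derive x 1 phi (g x)) ->
  continuous g -> vanishes_outside A phi -> (forall x, `|phi x| <= 1) ->
  ((\int[mu]_x (u x * g x))%:E <= TV u)%E.
Proof.
move=> hu dphi cg phi0 phi1.
have [tphi dE] := is_derive_TV_test dphi cg phi0 phi1.
have [M gM] := compact_support_bounded cg (derive_vanishes_outside dphi phi0).
apply: ereal_sup_ubound; exists phi => //; rewrite dE EFin_Rintegral//.
apply: L1M => //; first exact: continuous_measurable_fun.
by exists M; apply: aeW.
Qed.

Lemma TV_testP phi : TV_test phi -> exists A g,
  [/\ 0 < A, forall x, is_derive x 1 phi (g x), continuous g &
      vanishes_outside A phi].
Proof.
move=> [dphi cphi cpt _].
have [M [_ hM]] := compact_bounded cpt.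
(* Every radius above [M] bounds the support; this one is also positive. *)
exists (`|M| + 1), phi^`()%classic; split => //.
- by move=> x; rewrite derive1E; apply: DeriveDef.
move=> x Mx; apply/eqP/negPn/negP => phix.
have hx : closure [set y | phi y != 0] x by exact: subset_closure.
have lt_M : M < `|M| + 1 by rewrite ltr_pwDr// ler_norm.
by have := hM _ lt_M _ hx; rewrite /= leNgt Mx.
Qed.

Lemma TV_ge0 u : (0 <= TV u)%E.
Proof.
have [] := @is_derive_TV_test 0 (cst 0) (cst 0).
- by move=> x; exact: cvg_cst.
- by [].
- by move=> x; rewrite normr0.
move=> t0 dE; apply: ereal_sup_ubound; exists (cst 0) => //.
by rewrite dE; apply: integral0_eq => x _; rewrite mulr0.
Qed.

(** The sign of [c] moves to the test function, which stays admissible. *)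
Lemma TV_scale c u : L1 u -> (TV (fun x => c * u x)%R <= `|c|%:E * TV u)%E.
Proof.
move=> hu; apply: ge_ereal_sup => _ [phi tphi <-].
have [A [g [A0 dphi cg phi0]]] := TV_testP tphi.
have phi1 : forall x, `|phi x| <= 1 by case: tphi.
have [_ dE] := is_derive_TV_test dphi cg phi0 phi1.
pose s : R := Num.sg c.
have dsphi x : is_derive x 1 (fun y => s * phi y) (s * g x).
  exact: (is_deriveZ s (dphi x)).
have csg : continuous (fun x => s * g x).
  by move=> x; apply: cvgM; [exact: cvg_cst|exact: cg].
have sphi0 : vanishes_outside A (fun y => s * phi y).
  by move=> x Ax; rewrite phi0// mulr0.
have sphi1 x : `|s * phi x| <= 1.
  by rewrite normrM normr_sg mulr_ile1//; case: (c != 0).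
have [M gM] := compact_support_bounded csg (derive_vanishes_outside dsphi sphi0).
have hug : L1 (fun x => u x * (s * g x)).
  apply: L1M => //; first exact: continuous_measurable_fun.
  by exists M; apply: aeW.
have E x : c * u x * g x = `|c| * (u x * (s * g x)).
  by rewrite [c in LHS]numEsg -/s; lra.
rewrite dE; under eq_integral do rewrite E.
rewrite EFin_Rintegral; last exact: L1Z.
by rewrite RintegralZl// EFinM lee_wpmul2l ?lee_fin// (le_TV hu dsphi csg sphi0 sphi1).
Qed.

Lemma Rintegral_FTC (F f : R -> R) a b : a < b -> continuous f ->
  (forall x, is_derive x 1 F (f x)) ->
  \int[mu]_(x in `[a, b]) f x = F b - F a.
Proof.
move=> ab cf dF; rewrite /Rintegral.
have cF : continuous F.
  move=> x; apply/differentiable_continuous/derivable1_diffP.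
  exact: (@ex_derive _ _ _ _ _ _ _ (dF x)).
rewrite (@continuous_FTC2 _ f F a b)//.
- exact: continuous_subspaceT.
- split; [by move=> x _; exact: (@ex_derive _ _ _ _ _ _ _ (dF x))| |].
  + by apply: cvg_at_right_filter; exact: cF.
  + by apply: cvg_at_left_filter; exact: cF.
- by move=> x _; rewrite derive1E; exact: (@derive_val _ _ _ _ _ _ _ (dF x)).
Qed.

End TestFunctions.

(** * Reflections, translations and Young's inequality *)

Section Convolution.
Context {R : realType}.
Local Notation mu := (@lebesgue_measure R).
Implicit Types (x y r c A : R) (u v f g phi : R -> R).

(** The preimage of []a, b]] under [x -> c - x] is [[c - b, c - a[], of equal length, so the
    pushforward of [mu] is [mu] by uniqueness. *)
Lemma ge0_integral_reflect c (f : R -> \bar R) : measurable_fun [set: R] f ->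
  (forall x, 0 <= f x)%E ->
  (\int[mu]_x f (c - x)%R = \int[mu]_x f x)%E.
Proof.
move=> mf f0.
have mc : measurable_fun [set: measurableTypeR R]
   ((fun x => c - x) : measurableTypeR R -> measurableTypeR R).
  by apply: measurable_funB.
pose T := isMeasurableFun.Build _ _ _ _ _ mc.
pose h : {mfun measurableTypeR R >-> measurableTypeR R} := HB.pack (fun x => c - x) T.
have := @ge0_integral_pushforward _ _ _ _ R _ mc mu setT f measurableT mf.
move=> /(_ (fun y _ => f0 y)); rewrite preimage_setT => <-.
apply: eq_measure_integral => A mA _.
transitivity (pushforward mu h A); first by [].
apply/esym/lebesgue_measure_unique => //= _ [[a b]] _ <-.
rewrite /pushforward.
rewrite (_ : h @^-1` _ = `[c - b, c - a[%classic).
  rewrite !lebesgue_measure_itv/= !lte_fin ltrD2l ltrN2.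
  case: ifP => // _. rewrite -!EFinB; congr EFin; lra.
by apply/seteqP; split=> x; rewrite /= !in_itv/= => /andP[? ?]; apply/andP; split; lra.
Qed.

Lemma integral_norm_reflect c f : measurable_fun [set: R] f ->
  (\int[mu]_x (`|f (c - x)|)%:E = \int[mu]_x (`|f x|)%:E)%E.
Proof.
move=> mf; apply: (@ge0_integral_reflect c (fun x => (`|f x|)%:E)) => //.
by apply/measurable_EFinP; apply: measurableT_comp.
Qed.

Lemma measurable_reflect c f : measurable_fun [set: R] f ->
  measurable_fun [set: R] (fun x => f (c - x)).
Proof.
by move=> mf; apply: (measurableT_comp mf); apply: measurable_funB.
Qed.

Lemma L1_reflect c f : L1 f -> L1 (fun x => f (c - x)).
Proof.
move=> hf; have mf := L1_measurable hf.
apply/integrableP; split; first by apply/measurable_EFinP; exact: measurable_reflect.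
by have /integrableP[_] := hf; rewrite /= integral_norm_reflect.
Qed.

(** A translation is a composite of two reflections. *)
Lemma integral_norm_shift c f : measurable_fun [set: R] f ->
  (\int[mu]_x (`|f (x - c)|)%:E = \int[mu]_x (`|f x|)%:E)%E.
Proof.
move=> mf; rewrite -(integral_norm_reflect 0 mf).
rewrite -[RHS](integral_norm_reflect c (measurable_reflect 0 mf)).
by apply: eq_integral => x _; rewrite sub0r opprB.
Qed.

Lemma L1_convolution_integrand phi z x : L1 phi -> L1 z -> ess_bounded z ->
  L1 (fun y => phi (x - y) * z y).
Proof.
by move=> hphi hz bz; apply: L1M => //; [exact: L1_reflect|exact: L1_measurable].
Qed.

(** The bound holds at every [x], because an a.e. bound on [z] is enough under the integral. *)
Lemma convolution_bounded phi z : L1 phi -> L1 z -> ess_bounded z ->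
  exists M, forall x, `|convolution phi z x| <= M.
Proof.
move=> hphi hz [M zM]; have bz : ess_bounded z by exists M.
exists (\int[mu]_x `|M * phi x|) => x.
rewrite (le_trans (le_normr_Rintegral _ (L1_convolution_integrand x hphi hz bz)))//.
have mphi := L1_measurable hphi.
rewrite [leRHS](_ : _ = \int[mu]_y `|M * phi (x - y)|).
  apply: ae_le_Rintegral.
  - exact: (integrable_norm (L1_convolution_integrand x hphi hz bz)).
  - by apply: (@integrable_norm _ _ _ mu setT); apply: L1Z; exact: L1_reflect.
  - apply: filterS zM => y yM; rewrite mulrC !normrM ler_wpM2r//.
    by rewrite (le_trans yM)// ler_norm.
congr fine; rewrite (@integral_norm_reflect x (fun y => M * phi y))//.
exact: measurable_funM.
Qed.

Lemma L1_convolution phi z : L1 phi -> L1 z -> ess_bounded z ->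
  L1 (convolution phi z).
Proof.
move=> hphi hz bz.
have mphi := L1_measurable hphi; have mz := L1_measurable hz.
pose G (p : measurableTypeR R * measurableTypeR R) := (phi (p.1 - p.2) * z p.2)%:E.
have mG : measurable_fun [set: _] G.
  apply/measurable_EFinP; apply: measurable_funM.
    by apply: (measurableT_comp mphi); apply: measurable_funB.
  exact: (measurableT_comp mz).
have iG : (mu \x mu)%E.-integrable setT G.
  apply/integrable21ltyP => //.
  (* Integrating in [x] first, translation invariance leaves the factor [|z y|] as the only
     dependence on [y]. *)
  have -> : (\int[mu]_y \int[mu]_x `|G (x, y)| =
     \int[mu]_y ((\int[mu]_x `|phi x|%:E) * `|z y|%:E))%E.
    apply: eq_integral => y _; rewrite -(integral_norm_shift y mphi).
    rewrite -ge0_integralZr//.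
    - by apply: eq_integral => x _; rewrite /G/= normrM EFinM.
    - apply/measurable_EFinP; apply: measurableT_comp => //.
      by apply: (measurableT_comp mphi); apply: measurable_funB.
  have /integrableP[_ phioo] := hphi; have /integrableP[_ zoo] := hz.
  rewrite ge0_integralZl//.
  - rewrite lte_mul_pinfty//; first exact: integral_ge0.
    by rewrite ge0_fin_numE//; exact: integral_ge0.
  - by apply/measurable_EFinP; apply: measurableT_comp.
  - exact: integral_ge0.
have := integrable_fubini_F iG; congr (mu.-integrable setT _).
by apply/funext => x; rewrite /fubini_F /G/= EFin_Rintegral//; exact: L1_convolution_integrand.
Qed.

End Convolution.

(** * Functions of bounded variation are essentially bounded *)

Section BVBounded.
Context {R : realType}.
Local Notation mu := (@lebesgue_measure R).
Implicit Types (x y r c A : R) (u v f g phi : R -> R).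

(** Integration by parts against a single jump at [e]. The value [F A] need not be 0: in
    [Rintegral_hat] it is 1. *)
Lemma Rintegral_after (F f : R -> R) A e : continuous f ->
  (forall x, is_derive x 1 F (f x)) -> vanishes_outside A f -> e < A ->
  \int[mu]_x ((e < x)%R%:R * f x) = F A - F e.
Proof.
move=> cf dF f0 eA; rewrite -(Rintegral_FTC eA cf dF).
have ifA : mu.-integrable `[e, A] (EFin \o f).
  apply: continuous_compact_integrable; first exact: segment_compact.
  exact: continuous_subspaceT.
rewrite -Rintegral_itv_obnd_cbnd; last first.
  by apply: integrableS ifA => //; apply: subset_itvr; rewrite bnd_simp.
rewrite [RHS]Rintegral_mkcond; apply: eq_Rintegral => x _.
rewrite patchE; case: ifPn; rewrite ?notin_setE ?inE/= in_itv/=.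
  by move=> /andP[-> _]; rewrite mul1r.
have [ex|ex] := boolP (e < x); last by rewrite mul0r.
by move=> /negP; rewrite -ltNge => Ax; rewrite mul1r f0// (lt_le_trans Ax)// ler_norm.
Qed.

Lemma continuous_hat_shift r c : 0 < r -> continuous (fun y => hat r (y - c)).
Proof.
move=> r0 y; apply: (@continuous_comp _ _ _ (fun y => y - c) (hat r)).
  by apply: cvgB; [exact: cvg_id|exact: cvg_cst].
exact: continuous_hat.
Qed.

Lemma hat_shift_vanishes r c :
  vanishes_outside (r + `|c|) (fun y => hat r (y - c)).
Proof.
move=> y h; rewrite hat_eq0//.
by have := lerB_normD y (- c); rewrite normrN; lra.
Qed.

Lemma L1_hat_shift r c : 0 < r -> L1 (fun y => hat r (y - c)).
Proof.
move=> r0; apply: compact_support_L1; first exact: continuous_hat_shift.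
exact: hat_shift_vanishes.
Qed.

Lemma Rintegral_hat r c : 0 < r -> \int[mu]_y hat r (y - c) = 1.
Proof.
move=> r0.
have cf := @continuous_hat_shift _ c r0; have f0 := @hat_shift_vanishes r c.
have dF y : is_derive y 1 (fun y => ramp r (y - c)) (hat r (y - c)).
  by apply: is_derive_comp_shift; exact: is_derive_ramp.
have c0 := ler_norm c; have c1 := ler_norm (- c); rewrite normrN in c1.
(* The jump is put to the left of the support, so its indicator is 1 wherever the hat is nonzero. *)
have := @Rintegral_after _ _ _ (- (r + `|c|) - 1) cf dF f0.
rewrite ramp_ge//; last lra.
rewrite ramp_le//; last lra.
rewrite subr0 => <-; last lra.
apply: eq_Rintegral => y _; have [|h] := ltP; first by rewrite mul1r.
by rewrite (f0 y) ?mul0r// lter_normr; apply/orP; right; lra.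
Qed.

(** The hat is at most [r^-1] and lives on a ball of measure [2 * r], so averaging [|u - u x|]
    against it gives at most twice the mean [davg]. *)
Lemma dist_hat_average_le1 u x r : L1 u -> 0 < r ->
  (davg u x r <= (1 / 2)%:E)%E ->
  `|\int[mu]_y (u y * hat r (y - x)) - u x| <= 1.
Proof.
move=> hu r0 hd.
have mu_ := L1_measurable hu.
have hh := @L1_hat_shift _ x r0; have mh := L1_measurable hh.
have huh : L1 (fun y => u y * hat r (y - x)).
  apply: L1M => //; exists r^-1; apply: aeW => y.
  by have /andP[h1 h2] := @hat_bounds R r (y - x) r0; rewrite ger0_norm.
have ux : u x = \int[mu]_y (u x * hat r (y - x)).
  by rewrite RintegralZl// Rintegral_hat// mulr1.
rewrite [X in _ - X]ux -RintegralB//; last exact: L1Z.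
rewrite -lee_fin EFin_normr_Rintegral//; last first.
  by apply: L1B => //; exact: L1Z.
apply: le_trans (le_abse_integral _ _ _) _ => //.
  by apply/measurable_EFinP; apply: measurable_funB; apply: measurable_funM.
have mk : measurable_fun [set: R] (fun y => `|u y - u x|).
  by apply: measurableT_comp => //; exact: measurable_funB.
have mb : measurable (ball x r) by exact: measurable_ball.
apply: (@le_trans _ _ (\int[mu]_(y in ball x r) (r^-1%:E * `|u y - u x|%:E))%E).
  rewrite [leRHS]integral_mkcond; apply: ge0_le_integral => //.
  - apply: measurableT_comp => //; apply/measurable_EFinP.
    by apply: measurable_funB; apply: measurable_funM.
  - apply/(measurable_restrictT _ _).1 => //; apply/measurable_funTS.
    by apply: measurable_funeM; apply/measurable_EFinP.
  - move=> y _; rewrite patchE; case: ifPn => [_|].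
      rewrite -EFinM abse_EFin lee_fin -mulrBl normrM mulrC ler_wpM2r//.
      by have /andP[h1 h2] := @hat_bounds R r (y - x) r0; rewrite ger0_norm.
    rewrite notin_setE /ball/= => /negP; rewrite -leNgt distrC => h.
    by rewrite hat_eq0// !mulr0 subrr normr0.
rewrite ge0_integralZl//; last 2 first.
- by apply/measurable_EFinP; exact: measurable_funTS.
- by rewrite lee_fin invr_ge0 ltW.
move: hd; rewrite /davg /iavg lebesgue_measure_ball ?(ltW r0)//.
rewrite inver mulrn_eq0/= gt_eqF// lee_pdivrMl ?mulrn_wgt0// => hd.
by rewrite lee_pdivrMl// (le_trans hd)// -EFinM lee_fin; lra.
Qed.

Lemma BV_ess_bounded u : BV u -> ess_bounded u.
Proof.
move=> [hu Tu]; set T := fine (TV u).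
have TE : TV u = T%:E by rewrite fineK// ge0_fin_numE// TV_ge0.
pose I1 := \int[mu]_y (u y * hat 1 (y - 0)).
have bh r c : 0 < r -> ess_bounded (fun y => hat r (y - c)).
  move=> r0; exists r^-1; apply: aeW => y.
  by have /andP[h1 h2] := @hat_bounds R r (y - c) r0; rewrite ger0_norm.
have hI r c : 0 < r -> L1 (fun y => u y * hat r (y - c)).
  move=> r0; apply: L1M => //; last exact: bh.
  exact: L1_measurable (L1_hat_shift c r0).
have avg_le r c : 0 < r -> `|\int[mu]_y (u y * hat r (y - c)) - I1| <= T.
  move=> r0.
  (* Both ramps run from 0 to 1, so their difference has compact support and absolute value at most
     1; its derivative is the difference of the two hats. *)
  pose phi y := ramp r (y - c) - ramp 1 (y - 0).
  pose g y := hat r (y - c) - hat 1 (y - 0).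
  have dphi y : is_derive y 1 phi (g y).
    by apply: is_deriveB; apply: is_derive_comp_shift; exact: is_derive_ramp.
  have cg : continuous g.
    by move=> y; apply: cvgB; exact: continuous_hat_shift.
  have phi0 : vanishes_outside (r + `|c| + 1) phi.
    move=> y hy; have c0 := ler_norm c; have c1 := ler_norm (- c).
    rewrite normrN in c1; rewrite /phi; move: hy; rewrite lter_normr => /orP[] hy.
      by rewrite !ramp_ge ?subrr//; lra.
    by rewrite !ramp_le ?subrr//; lra.
  have phi1 y : `|phi y| <= 1.
    have := @ramp_bounds R r (y - c) r0; have := @ramp_bounds R 1 (y - 0) ltr01.
    by rewrite /phi ler_norml; lra.
  have E : \int[mu]_y (u y * g y) = \int[mu]_y (u y * hat r (y - c)) - I1.
    rewrite -RintegralB//; [|exact: hI|exact: hI].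
    by apply: eq_Rintegral => y _; rewrite mulrBr.
  rewrite -E ler_norml; apply/andP; split; last first.
    by rewrite -lee_fin -TE; exact: (le_TV hu dphi cg phi0 phi1).
  (* The lower bound comes from testing with [- phi]. *)
  have dphiN y : is_derive y 1 (fun y => - phi y) (- g y) by exact: is_deriveN.
  have := @le_TV _ (r + `|c| + 1) u _ _ hu dphiN _ _ _.
  rewrite TE => h.
  have : (\int[mu]_y (u y * - g y) <= T).
    rewrite -lee_fin; apply: h.
    - by move=> y; apply: cvgN; exact: cg.
    - by move=> y hy; rewrite phi0 ?oppr0.
    - by move=> y; rewrite normrN.
  suff -> : \int[mu]_y (u y * - g y) = - \int[mu]_y (u y * g y) by lra.
  rewrite -mulN1r -RintegralZl//.
    by apply: eq_Rintegral => y _; rewrite mulrN mulN1r.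
  rewrite (_ : (EFin \o _) = EFin \o (fun y => u y * hat r (y - c) - u y * hat 1 (y - 0))).
    by apply: L1B; exact: hI.
  by apply/funext => y; rewrite /= mulrBr.
(* At a Lebesgue point, 1 bounds the distance from [u x] to a hat average, and [T] the distance from
   that average to the reference average [I1]. *)
exists (1 + T + `|I1|).
have loc : locally_integrable setT u by apply: open_integrable_locally => //; exact: openT.
apply: filterS (lebesgue_differentiation loc) => x ux.
have half0 : (0 < (1 / 2 : R)%:E)%E by rewrite lte_fin; lra.
have [r [r0 hr]] : exists r, 0 < r /\ (davg u x r <= (1 / 2)%:E)%E.
  have hnear := ux _ (open_ereal_lt' half0).
  near (0%R:R)^'+ => r; exists r; split; first by near: r; exact: nbhs_right_gt.
  by apply: ltW; near: r.
have := dist_hat_average_le1 hu r0 hr; have := avg_le r x r0.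
set U := Rintegral _ _ _; rewrite !ler_norml => h1 h2.
by have := ler_norm I1; have := ler_norm (- I1); rewrite normrN; lra.
Unshelve. all: by end_near. Qed.

End BVBounded.

(** * Part (1): the zero minimiser and the dual norm *)

Section ZeroMinimiser.
Context {R : realType}.
Local Notation mu := (@lebesgue_measure R).
Implicit Types (c lambda : R) (u v f g : R -> R).

Lemma L1_cst0 : L1 (cst 0 : R -> R).
Proof. exact: integrable0. Qed.

Lemma TV_cst0 : TV (cst 0 : R -> R) = 0%E.
Proof.
apply/eqP; rewrite eq_le TV_ge0 andbT.
have := @TV_scale R 0 (cst 0) L1_cst0.
rewrite normr0 mul0e; congr (_ <= _)%E; congr TV.
by apply/funext => x; rewrite mul0r.
Qed.

Lemma BV_cst0 : BV (cst 0 : R -> R).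
Proof. by split; [exact: L1_cst0|rewrite /= TV_cst0]. Qed.

Lemma BV_TVE u : BV u -> TV u = (fine (TV u))%:E.
Proof. by move=> [_ Tu]; rewrite fineK// ge0_fin_numE// TV_ge0. Qed.

Lemma BV_scale c u : BV u -> BV (fun x => c * u x).
Proof.
move=> hu; split; first by apply: L1Z; case: hu.
rewrite /= (le_lt_trans (TV_scale c hu.1))// (BV_TVE hu) -EFinM ltry//.
Qed.

Lemma Rintegral_sqrB u f : L1 u -> ess_bounded u -> L1 f -> ess_bounded f ->
  \int[mu]_x ((u x - f x) ^+ 2) =
  \int[mu]_x (u x ^+ 2) - 2 * \int[mu]_x (f x * u x) + \int[mu]_x (f x ^+ 2).
Proof.
move=> hu bu hf bf.
have iu := L1_sqr hu bu; have i_f := L1_sqr hf bf.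
have iuf : L1 (fun x => f x * u x) by apply: L1M => //; exact: L1_measurable.
rewrite -RintegralZl// -RintegralB//; last exact: L1Z.
rewrite -RintegralD//; last by apply: L1B => //; exact: L1Z.
by apply: eq_Rintegral => x _; lra.
Qed.

Lemma F1_BV lambda f u : BV u -> L1 f -> ess_bounded f ->
  F1 lambda f u = (fine (TV u) + lambda * (\int[mu]_x (u x ^+ 2) -
    2 * \int[mu]_x (f x * u x) + \int[mu]_x (f x ^+ 2)))%:E.
Proof.
move=> hu hf bf; have bu := BV_ess_bounded hu; have [iu _] := hu.
by rewrite F1E// (BV_TVE hu) -EFinD Rintegral_sqrB.
Qed.

Lemma F1_cst0 lambda f : L1 f -> ess_bounded f ->
  F1 lambda f (cst 0) = (lambda * \int[mu]_x (f x ^+ 2))%:E.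
Proof.
move=> hf bf; rewrite F1_BV//; last exact: BV_cst0.
rewrite TV_cst0/=.
have z1 : \int[mu]_x (0 ^+ 2) = 0 :> R by rewrite expr0n/= Rintegral_cst//= mul0r.
have z2 : \int[mu]_x (f x * 0) = 0.
  by under eq_Rintegral do rewrite mulr0; rewrite Rintegral_cst//= mul0r.
by rewrite z1 z2 mulr0 !add0r oppr0 add0r.
Qed.

(** Homogeneity of the dual bound. If [TV u > 0], normalise [u] to variation 1; if [TV u = 0], every
    multiple of [u] is admissible, which forces the pairing to be 0. *)
Lemma dual_norm_pairing f u c : L1 f -> ess_bounded f -> 0 <= c ->
  (dual_norm f <= c%:E)%E -> BV u ->
  `|\int[mu]_x (f x * u x)| <= c * fine (TV u).
Proof.
move=> hf bf c0 fc hu; have [iu _] := hu.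
have ifu : L1 (fun x => f x * u x).
  by apply: L1M => //; [exact: L1_measurable|exact: BV_ess_bounded].
have key a : 0 <= a -> a * fine (TV u) <= 1 ->
    a * `|\int[mu]_x (f x * u x)| <= c.
  move=> a0 aT.
  rewrite -lee_fin; apply: le_trans fc; apply: ereal_sup_ubound.
  exists (fun x => a * u x).
    split; first exact: L1Z.
    rewrite (le_trans (TV_scale a iu))// (BV_TVE hu) -EFinM lee_fin.
    by rewrite (ger0_norm a0).
  have -> : (fun x => (f x * (a * u x))%:E) = (fun x => (a * (f x * u x))%:E).
    by apply/funext => x; congr EFin; lra.
  rewrite EFin_Rintegral; last exact: L1Z.
  by rewrite RintegralZl// abse_EFin normrM (ger0_norm a0).
have T0 : 0 <= fine (TV u) by rewrite fine_ge0// TV_ge0.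
move: T0; rewrite le_eqVlt => /predU1P[T0|T0].
  rewrite -T0 mulr0.
  set I := `|_| in key *; have [//|I0] := leP I 0.
  (* For this multiple the pairing would be [c + 1], above the bound [c]. *)
  have := key ((c + 1) / I); rewrite -T0 mulr0 divfK ?gt_eqF//.
  have : 0 <= (c + 1) / I by rewrite divr_ge0// ltW// ltr_wpDl.
  by move=> h /(_ h) /(_ ler01); lra.
have := key (fine (TV u))^-1.
rewrite invr_ge0 (ltW T0) mulVf ?gt_eqF// => /(_ isT) /(_ (lexx _)).
by rewrite mulrC ler_pdivrMr.
Qed.

Lemma unique_minimiser_cst0 lambda f : 0 < lambda -> L1 f -> ess_bounded f ->
  unique_minimiser (F1 lambda f) BV (cst 0) <->
  (dual_norm f <= (1 / (2 * lambda))%:E)%E.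
Proof.
move=> l0 hf bf; split=> [[_ min0 _]|fl].
  apply: ge_ereal_sup => _ [v [iv Tv] <-].
  have hv : BV v by split => //; rewrite /= (le_lt_trans Tv)// ltry.
  have bv := BV_ess_bounded hv.
  have ifv : L1 (fun x => f x * v x) by apply: L1M => //; exact: L1_measurable.
  rewrite EFin_Rintegral// abse_EFin lee_fin.
  set I := Rintegral _ _ _; set V := \int[mu]_x (v x ^+ 2).
  have V0 : 0 <= V by apply: Rintegral_ge0 => x _; exact: sqr_ge0.
  (* Minimality of 0 against [t * v], after cancelling the common term in [f ^+ 2]. *)
  have key t : 2 * lambda * t * I <= `|t| + lambda * t ^+ 2 * V.
    have htv := BV_scale t hv.
    have := min0 _ htv; rewrite F1_cst0// (F1_BV _ htv)// lee_fin.
    have -> : \int[mu]_x ((t * v x) ^+ 2) = t ^+ 2 * V.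
      by rewrite -RintegralZl//; [apply: eq_Rintegral => x _; rewrite exprMn|exact: L1_sqr].
    have -> : \int[mu]_x (f x * (t * v x)) = t * I.
      by rewrite -RintegralZl//; apply: eq_Rintegral => x _; lra.
    have : fine (TV (fun x => t * v x)) <= `|t|.
      rewrite -lee_fin -(BV_TVE htv) (le_trans (TV_scale t iv))//.
      by rewrite -[leRHS]mule1 lee_wpmul2l// lee_fin.
    by move: (fine _) (\int[mu]_x (f x ^+ 2)) => T F; nra.
  (* Both signs of [t] give the absolute value of [I]; dividing by [e] leaves an error linear in
     [e]. *)
  have key2 e : 0 < e -> 2 * lambda * `|I| <= 1 + lambda * e * V.
    move=> e0; rewrite -(ler_pM2l e0).
    have := key e; have := key (- e); rewrite normrN (gtr0_norm e0).
    by case: (ger0P I) => _; nra.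
  rewrite ler_pdivlMr ?mulr_gt0// leNgt; apply/negP => I1.
  (* One value of [e] replaces the limit: for [e = d / (lambda * V + 1)] the error [lambda * e * V]
     is [d - e], below the excess [d]. *)
  pose d := `|I| * (2 * lambda) - 1; have d0 : 0 < d by rewrite subr_gt0.
  have lV : 0 < lambda * V + 1 by rewrite ltr_wpDl// mulr_ge0// ltW.
  have := key2 (d / (lambda * V + 1)); rewrite divr_gt0// => /(_ isT).
  have : d / (lambda * V + 1) * (lambda * V + 1) = d by rewrite divfK// gt_eqF.
  have : 0 < d / (lambda * V + 1) by rewrite divr_gt0.
  by move: (d / _) => q; rewrite /d; nra.
(* By the dual bound the variation outweighs the linear term; the quadratic surplus gives minimality
   and uniqueness at once. *)
have key u : BV u -> (F1 lambda f (cst 0)%R + (lambda * \int[mu]_x (u x ^+ 2))%R%:E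
    <= F1 lambda f u)%E.
  move=> hu; rewrite F1_cst0// (F1_BV _ hu)// -EFinD lee_fin.
  have c0 : 0 <= 1 / (2 * lambda) by rewrite divr_ge0// mulr_ge0// ltW.
  have := dual_norm_pairing hf bf c0 fl hu.
  rewrite mul1r mulrC ler_pdivlMr ?mulr_gt0//.
  have := ler_norm (\int[mu]_x (f x * u x)).
  by move: (fine _) (\int[mu]_x (f x ^+ 2)) (\int[mu]_x (f x * u x)) => T F I; nra.
have sq0 u : 0 <= \int[mu]_x (u x ^+ 2).
  by apply: Rintegral_ge0 => x _; exact: sqr_ge0.
split; first exact: BV_cst0.
- move=> v hv; apply: le_trans (key v hv).
  by rewrite leeDl// lee_fin mulr_ge0// ltW.
- move=> u hu umin; have [iu _] := hu.
  have := le_trans (key u hu) (umin _ BV_cst0).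
  rewrite F1_cst0// -EFinD lee_fin gerDl pmulr_rle0// => u0.
  have u20 : {ae mu, forall x, 0 <= u x ^+ 2} by apply: aeW => x; exact: sqr_ge0.
  apply: filterS (ae_ge0_Rintegral_le0 (L1_sqr iu (BV_ess_bounded hu)) u20 u0).
  by move=> x /eqP; rewrite sqrf_eq0 => /eqP.
Qed.

End ZeroMinimiser.

(** * The jumps of a bar code *)

Section Edges.
Context {R : realType}.
Local Notation mu := (@lebesgue_measure R).
Implicit Types (N m p q j : nat) (e a : nat -> R) (x : R).

Lemma sum_sign_odd p : \sum_(j < p) (-1) ^+ j = (odd p)%:R :> R.
Proof.
elim: p => [|p IHp]; first by rewrite big_ord0.
rewrite big_ord_recr/= IHp -signr_odd; case: (odd p) => /=; rewrite ?expr0 ?expr1; lra.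
Qed.

(** Saturated terms before [p] cancel down to a parity. The window that remains is empty for step
    functions and has one or two terms for blurred ones. *)
Lemma alternating_sum_split N p q a : (p <= q <= N)%N ->
  (forall j, (j < p)%N -> a j = 1) -> (forall j, (q <= j < N)%N -> a j = 0) ->
  \sum_(j < N) (-1) ^+ j * a j =
  (odd p)%:R + \sum_(p <= j < q) (-1) ^+ j * a j.
Proof.
move=> /andP[pq qN] a1 a0.
rewrite -(big_mkord xpredT (fun j => (-1) ^+ j * a j)).
rewrite (big_cat_nat _ qN)//= (big_cat_nat _ pq)//=.
rewrite [X in _ + X](_ : _ = 0) ?addr0; last first.
  rewrite big_seq; apply: big1 => j.
  by rewrite mem_index_iota => hj; rewrite a0 ?mulr0.
congr (_ + _); rewrite -sum_sign_odd -(big_mkord xpredT (fun j => (-1) ^+ j)).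
by apply: eq_big_nat => j /andP[_ jp]; rewrite a1// mulr1.
Qed.

(** The alternating series estimate: the tail after the first term is of the same kind with bound
    [a 0], and is subtracted from [a 0]. *)
Lemma alternating_sum_bounds n a (c : R) : 0 <= c ->
  (forall j, (j < n)%N -> 0 <= a j <= c) ->
  (forall i j, (i < j < n)%N -> a j <= a i) ->
  0 <= \sum_(j < n) (-1) ^+ j * a j <= c.
Proof.
elim: n a c => [|n IHn] a c c0 ac adec; first by rewrite big_ord0 lexx.
rewrite big_ord_recl/= expr0 mul1r.
have -> : \sum_(i < n) (-1) ^+ bump 0 i * a (bump 0 i) =
    - \sum_(i < n) (-1) ^+ i * a i.+1.
  rewrite -sumrN; apply: eq_bigr => i _.
  by rewrite /bump/= add1n exprS mulN1r mulNr.
have /andP[a0 a0c] := ac 0%N isT.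
have := IHn (fun j => a j.+1) (a 0%N) a0; set s := \sum_(_ < _) _.
have h1 j : (j < n)%N -> 0 <= a j.+1 <= a 0%N.
  by move=> jn; rewrite adec// andbT; have /andP[] := ac j.+1 jn.
have h2 i j : (i < j < n)%N -> a j.+1 <= a i.+1 by move=> ij; apply: adec.
by move=> /(_ h1 h2); lra.
Qed.

(** Upward jumps carry even indices and downward ones odd indices, so an increasing [e] gives a 0/1
    function. *)
Definition step_sum N e x : R := \sum_(j < N) (-1) ^+ j * (e j < x)%R%:R.

Definition increasing_edges N e := forall j k, (j < k < N)%N -> e j < e k.

Lemma locate_edges N e x : increasing_edges N e ->
  (forall j, (j < N)%N -> x != e j) ->
  exists m, [/\ (m <= N)%N, forall j, (j < m)%N -> e j < x &
                forall j, (m <= j < N)%N -> x < e j].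
Proof.
elim: N => [|N IHN] einc xe; first by exists 0%N; split => // j; rewrite ltn0 andbF.
have [||m [mN h1 h2]] := IHN.
- by move=> j k /andP[jk kN]; apply: einc; rewrite jk ltnW.
- by move=> j jN; apply: xe; exact: ltnW.
have := xe N (ltnSn N); rewrite neq_lt => /orP[xN|Nx].
  exists m; split => //; first exact: leqW.
  move=> j /andP[mj]; rewrite ltnS leq_eqVlt => /predU1P[->//|jN].
  by apply: h2; rewrite mj.
exists N.+1; split => //.
  move=> j; rewrite ltnS leq_eqVlt => /predU1P[->//|jN].
  by rewrite (lt_trans _ Nx)// einc// jN ltnSn.
by move=> j /andP[/leq_ltn_trans h /h]; rewrite ltnn.
Qed.

Lemma step_sum_odd N e x m : (m <= N)%N ->
  (forall j, (j < m)%N -> e j < x) -> (forall j, (m <= j < N)%N -> x <= e j) ->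
  step_sum N e x = (odd m)%:R.
Proof.
move=> mN h1 h2; rewrite /step_sum.
rewrite (@alternating_sum_split N m m (fun j => (e j < x)%R%:R)) ?leqnn//.
- by rewrite big_geq// addr0.
- by move=> j /h1 ->.
- by move=> j /h2; rewrite leNgt => /negbTE ->.
Qed.

Lemma spaced_edges omega N e : 0 < omega ->
  (forall j, (j.+1 < N)%N -> omega <= e j.+1 - e j) ->
  forall j k, (j < k < N)%N -> omega <= e k - e j.
Proof.
move=> o0 gap j; elim=> [|k IHk]; first by rewrite ltn0.
rewrite ltnS leq_eqVlt => /andP[/predU1P[->|jk] kN]; first exact: gap.
have := gap _ kN; have := IHk; rewrite jk (ltnW kN) => /(_ isT); lra.
Qed.

(** The jumps are the cut points [t i], except that 0 or 1 is no jump when the adjacent interval is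
    a white space, as [z] is 0 outside [[0, 1]]. Jumps alternate and lead from 0 back to 0, so their
    number is even. *)
Lemma barcode_edges omega z : 0 < omega -> barcode_width omega z ->
  exists N e, [/\ ~~ odd N, forall j, (j < N)%N -> 0 <= e j <= 1,
    forall j, (j.+1 < N)%N -> omega <= e j.+1 - e j &
    {ae mu, forall x, z x = step_sum N e x}].
Proof.
move=> o0 [[_ [_ z0]] [n [b [t [[n0 t0 tn tinc zt] gap]]]]].
have tinc' : increasing_edges n.+1 t.
  have g : forall j, (j.+1 < n.+1)%N -> omega <= t j.+1 - t j.
    by move=> j; rewrite ltnS; exact: gap.
  by move=> j k jk; have := spaced_edges o0 g jk; lra.
(* [s0] and [s1] count the cut points discarded at 0 and at 1. For a single white space, [n = 1],
   both are discarded and [N = 0]. *)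
pose s0 := nat_of_bool (~~ b); pose s1 := nat_of_bool (~~ (b (+) odd n.-1)).
pose N := (n.+1 - (s0 + s1))%N; pose e j := t (j + s0)%N.
have s0n : (s0 <= n)%N by rewrite /s0; case: b {zt s0 s1 N e}; case: n n0 {t0 tn tinc gap tinc'}.
have Nlt j : (j < N)%N -> (j + s0 < n.+1)%N by rewrite /N; lia.
have tb j : (j <= n)%N -> 0 <= t j <= 1.
  move=> jn; apply/andP; split.
    by case: j jn => [|j] jn; [rewrite t0|rewrite -t0 ltW// tinc'// ltnS].
  move: jn; rewrite leq_eqVlt => /predU1P[->|jn]; first by rewrite tn.
  by rewrite -tn ltW// tinc'// jn ltnSn.
have Neven : ~~ odd N.
  rewrite /N /s0 /s1; case: n n0 {t0 tn tinc zt gap tinc' s0 s1 N e s0n Nlt tb} => // n _ /=.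
  by case: b => /=; case: (boolP (odd n)) => /= on; rewrite ?subn0 ?subSS ?subn0/= ?on ?negbK.
have s11 : (s1 <= 1)%N by rewrite /s1; case: (_ (+) _).
exists N, e; split => //.
- by move=> j jN; apply: tb; rewrite -ltnS; exact: Nlt.
- move=> j jN; rewrite /e addSn; apply: gap; have := Nlt _ jN; lia.
have zt' : {ae mu, forall x, forall i, (i < n)%N -> `]t i, t i.+1[%classic x ->
    z x = (b (+) odd i)%:R}.
  apply: ae_foralln => i; have [iN|] := boolP (i < n)%N; last by move=> _; apply: aeW.
  by apply: filterS (zt i iN) => x h _.
have xt : {ae mu, forall x, forall i, x != t i}.
  apply: ae_foralln => i; exists [set t i]; split => //.
    exact: lebesgue_measure_set1.
  by move=> x /= /negP/negPn/eqP.
apply: filterS3 z0 zt' xt => x zx0 zx xt.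
(* [m] counts the cut points left of [x]: 0 and [n.+1] put [x] outside [[0, 1]], any other value
   puts it in the interval of index [m.-1]. *)
have [m [mN h1 h2]] := @locate_edges n.+1 t x tinc' (fun j _ => xt j).
case: m mN h1 h2 => [|m] mN h1 h2.
  rewrite zx0; last by rewrite /= in_itv/= -t0 leNgt h2.
  rewrite (@step_sum_odd _ _ _ 0)// => j jN; rewrite ltW// h2//.
  exact: Nlt.
move: mN; rewrite ltnS leq_eqVlt => /predU1P[mn|mn].
  rewrite zx0; last by rewrite /= in_itv/= -tn -mn [x <= _]leNgt h1// andbF.
  rewrite (@step_sum_odd _ _ _ N) ?(negbTE Neven)//.
  - by move=> j jN; rewrite /e h1// mn; exact: Nlt.
  - by move=> j /andP[/leq_ltn_trans h /h]; rewrite ltnn.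
have xm : `]t m, t m.+1[%classic x.
  by rewrite /= in_itv/= h1// h2// leqnn ltnS.
rewrite (zx m mn xm).
rewrite (@step_sum_odd _ _ _ (m.+1 - s0)%N).
- by rewrite /s0; case: (b); rewrite /= ?subn0 ?subn1.
- by rewrite /N; lia.
- by move=> j jm; rewrite /e h1//; lia.
- by move=> j jm; rewrite /e ltW// h2//; have := Nlt j; lia.
Qed.

End Edges.

(** * Smooth steps whose slope is proportional to the contrast *)

Section Steps.
Context {R : realType}.
Local Notation mu := (@lebesgue_measure R).
Implicit Types (sigma a b x : R).

(* [(-1) ^+ k * contrast sigma (e k) (e k.+1)] is [2 f - 1] on the k-th bar or
   white space when f is the blurred bar code. *)
Definition contrast sigma a b x :=
  2 * (ramp sigma (x - a) + ramp sigma (b - x)) - 3.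

Lemma continuous_ramp sigma : 0 < sigma -> continuous (ramp sigma).
Proof.
move=> s0 x; apply/differentiable_continuous/derivable1_diffP.
exact: (@ex_derive _ _ _ _ _ _ _ (is_derive_ramp x s0)).
Qed.

Lemma continuous_contrast sigma a b : 0 < sigma -> continuous (contrast sigma a b).
Proof.
move=> s0 x; apply: cvgB; last exact: cvg_cst.
apply: cvgM; first exact: cvg_cst.
apply: cvgD.
  apply: (@continuous_comp _ _ _ (fun y => y - a) (ramp sigma)); last exact: continuous_ramp.
  by apply: cvgB; [exact: cvg_id|exact: cvg_cst].
apply: (@continuous_comp _ _ _ (fun y => b - y) (ramp sigma)); last exact: continuous_ramp.
by apply: cvgB; [exact: cvg_cst|exact: cvg_id].
Qed.

Lemma contrast_gt0 sigma a b x : 0 < sigma -> sigma <= b - a -> a < x < b ->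
  0 < contrast sigma a b x.
Proof.
move=> s0 sab /andP[ax xb].
have := @rampD_gt R sigma (x - a) (b - x) s0; rewrite /contrast => h.
have : 3 / 2 < ramp sigma (x - a) + ramp sigma (b - x) by apply: h; lra.
lra.
Qed.

(** Outside the interval one ramp is at most 1/2 and the other at most 1. With [contrast_gt0], the
    positive part of the contrast is thus a continuous truncation to [[a, b]]. *)
Lemma contrast_le0 sigma a b x : 0 < sigma -> x <= a \/ b <= x ->
  contrast sigma a b x <= 0.
Proof.
have aux y : 0 < sigma -> y <= 0 -> ramp sigma y <= 1 / 2.
  move=> s0; rewrite le_eqVlt => /predU1P[->|y0]; first by rewrite ramp0.
  by rewrite ltW// ramp_lt_half.
move=> s0; rewrite /contrast => -[xa|bx].
  have r1 : ramp sigma (x - a) <= 1 / 2 by apply: aux => //; lra.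
  by have := @ramp_bounds R sigma (b - x) s0; lra.
have r1 : ramp sigma (b - x) <= 1 / 2 by apply: aux => //; lra.
by have := @ramp_bounds R sigma (x - a) s0; lra.
Qed.

(** With [P] the primitive of the ramp, the integral is [4 * (P (b - a) - P 0) - 3 * (b - a)], where
    [P (b - a) = b - a] and [P 0 = sigma / 6]. *)
Lemma Rintegral_contrast sigma a b : 0 < sigma -> sigma <= b - a ->
  \int[mu]_(x in `[a, b]) contrast sigma a b x = b - a - 2 / 3 * sigma.
Proof.
move=> s0 sab; have ab : a < b by lra.
pose H x := 2 * (ramp_primitive sigma (x - a) - ramp_primitive sigma (b - x)) - 3 * x.
suff dH x : is_derive x 1 H (contrast sigma a b x).
  rewrite (Rintegral_FTC ab (continuous_contrast (a := a) (b := b) s0) dH).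
  by rewrite /H !subrr ramp_primitive0// ramp_primitive_ge//; lra.
have h1 : is_derive x 1 (fun y => ramp_primitive sigma (y - a)) (ramp sigma (x - a)).
  by apply: is_derive_comp_shift; exact: is_derive_ramp_primitive.
have h2 : is_derive x 1 (fun y => ramp_primitive sigma (b - y)) (- ramp sigma (b - x)).
  by apply: is_derive_comp_reflect; exact: is_derive_ramp_primitive.
have := is_deriveB (is_deriveZ (2 : R) (is_deriveB h1 h2))
  (is_deriveZ (3 : R) (is_derive_id (x : R) 1)).
congr (is_derive x 1 _ _).
by rewrite /contrast opprK /GRing.scale/= mulr1.
Qed.

(** [S] is the distribution function of the density obtained by normalising the positive part of the
    contrast. The calibration is assembled from such steps. *)
Lemma contrast_step sigma a b : 0 < sigma -> sigma <= b - a -> exists S : R -> R,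
  [/\ forall x, is_derive x 1 S
        ((b - a - 2 / 3 * sigma)^-1 * Num.max 0 (contrast sigma a b x)),
      forall x, x <= a -> S x = 0, forall x, b <= x -> S x = 1 &
      forall x, 0 <= S x <= 1].
Proof.
move=> s0 sab; set c := (b - a - 2 / 3 * sigma)^-1.
have c0 : 0 < c by rewrite invr_gt0; lra.
pose k x := c * Num.max 0 (contrast sigma a b x).
have k0 x : 0 <= k x by rewrite mulr_ge0 ?(ltW c0)// le_max lexx.
have ck : continuous k.
  move=> x; apply: cvgM; first exact: cvg_cst.
  by apply: continuous_max; [exact: cvg_cst|exact: continuous_contrast].
have k_out x : x <= a \/ b <= x -> k x = 0.
  by move=> h; rewrite /k max_l ?mulr0// contrast_le0.
have kv : vanishes_outside (`|a| + `|b|) k.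
  move=> x; rewrite lter_normr => /orP[] h; apply: k_out.
    by right; have := ler_norm b; have := normr_ge0 a; lra.
  by left; have := ler_norm (- a); rewrite normrN; have := normr_ge0 b; lra.
have ik : L1 k by exact: compact_support_L1 ck kv.
have Ik : \int[mu]_x k x = 1.
  transitivity (\int[mu]_(x in `[a, b]) (c * contrast sigma a b x)).
    rewrite [RHS]Rintegral_mkcond; apply: eq_Rintegral => x _.
    rewrite patchE; case: ifPn; rewrite ?notin_setE ?inE/= in_itv/=.
      move=> /andP[]; rewrite le_eqVlt => /predU1P[<-|ax].
        (* At [a], and likewise at [b], one ramp is 1/2 and the other is 1 because [sigma <= b - a],
           so the contrast vanishes. *)
        rewrite k_out; last by left.
        rewrite /contrast subrr ramp0 ramp_ge//; lra.
      rewrite le_eqVlt => /predU1P[->|xb].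
        rewrite k_out; last by right.
        rewrite /contrast subrr ramp0 ramp_ge//; lra.
      by rewrite /k max_r// ltW// contrast_gt0// ax.
    move=> /negP; rewrite negb_and -!ltNge => /orP[] h; apply: k_out; lra.
  have icontrast : lebesgue_measure.-integrable `[a, b] (EFin \o contrast sigma a b).
    apply: continuous_compact_integrable; first exact: segment_compact.
    by apply: continuous_subspaceT; exact: continuous_contrast.
  by rewrite RintegralZl// Rintegral_contrast// mulVf// gt_eqF// -invr_gt0.
pose S x := \int[mu]_(t in `]-oo, x]) k t.
have ikS (A : set R) : measurable A -> mu.-integrable A (EFin \o k).
  by move=> mA; exact: integrableS ik.
have S0 x : 0 <= S x by apply: Rintegral_ge0.
have S1 x : S x <= 1.
  rewrite -Ik /S Rintegral_mkcond; apply: le_Rintegral => //.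
    rewrite -restrict_EFin; apply: (integrable_mkcond _ _).1 => //; exact: ikS.
  by move=> y _; rewrite patchE; case: ifP.
exists S; split => //.
- move=> x; have [] := @continuous_FTC1 R k -oo%O x (x + 1) _ (ikS _ _) _ (ck x) => //.
  + by rewrite ltrDl.
  + by rewrite ltNyr.
  + by rewrite derive1E => dS dSE; apply: DeriveDef.
- move=> x xa; rewrite /S (@eq_Rintegral _ _ _ _ _ (cst 0)).
    by rewrite Rintegral_cst//= mul0r.
  move=> y; rewrite inE/= in_itv/= => yx; rewrite k_out//; left; exact: le_trans xa.
- move=> x bx; rewrite -Ik /S Rintegral_mkcond; apply: eq_Rintegral => y _.
  rewrite patchE; case: ifPn => //; rewrite notin_setE/= in_itv/= => /negP.
  by rewrite -ltNge => xy; rewrite k_out//; right; rewrite ltW// (le_lt_trans bx).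
- by move=> x; rewrite S0 S1.
Qed.

End Steps.

(** * Construction of the calibration *)

Section Calibration.
Context {R : realType}.
Local Notation mu := (@lebesgue_measure R).
Implicit Types (sigma lambda x : R) (N k : nat) (e : nat -> R).

Definition blurred sigma N e x : R := \sum_(j < N) (-1) ^+ j * ramp sigma (x - e j).

(** Gaps of at least [sigma] saturate every ramp except those of the two neighbouring jumps. *)
Lemma blurred_between sigma N e k x : 0 < sigma ->
  (forall i j, (i < j < N)%N -> sigma <= e j - e i) ->
  (k.+1 < N)%N -> e k < x < e k.+1 ->
  2 * blurred sigma N e x - 1 = (-1) ^+ k * contrast sigma (e k) (e k.+1) x.
Proof.
move=> s0 gap kN /andP[kx xk].
rewrite /blurred (@alternating_sum_split _ N k k.+2 (fun j => ramp sigma (x - e j))).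
- rewrite big_nat_recr//= big_nat1 /contrast.
  have -> : e k.+1 - x = - (x - e k.+1) by lra.
  rewrite rampN exprS -signr_odd; case: (odd k) => /=; rewrite ?expr0 ?expr1; lra.
- by lia.
- move=> j jk; apply: ramp_ge => //; have := gap j k; rewrite jk (ltnW kN) => /(_ isT); lra.
- move=> j /andP[kj jN]; apply: ramp_le => //; have := gap k.+1 j; rewrite kj jN => /(_ isT); lra.
Qed.

(** Only the jump nearest to [x] can be unsaturated. Since [N] is even the last jump goes down, so
    both sides behave alike. *)
Lemma blurred_outside sigma N e x : 0 < sigma -> ~~ odd N ->
  (forall i j, (i < j < N)%N -> sigma <= e j - e i) ->
  (forall j, (j < N)%N -> x < e j) \/ (forall j, (j < N)%N -> e j < x) ->
  blurred sigma N e x < 1 / 2.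
Proof.
move=> s0 Neven gap; case: N Neven gap => [|N] Neven gap.
  by move=> _; rewrite /blurred big_ord0; lra.
move=> [xe|ex]; rewrite /blurred.
  rewrite (@alternating_sum_split _ N.+1 0 1 (fun j => ramp sigma (x - e j)))//.
    rewrite big_nat1 expr0 mul1r/= add0r ramp_lt_half//.
    by have := xe 0%N isT; lra.
  move=> j /andP[j0 jN]; apply: ramp_le => //.
  by have := xe 0%N isT; have := gap 0%N j; rewrite j0 jN => /(_ isT); lra.
rewrite (@alternating_sum_split _ N.+1 N N.+1 (fun j => ramp sigma (x - e j))).
- rewrite big_nat1 -signr_odd; move: Neven; rewrite /= negbK => -> /=.
  have -> : x - e N = - (e N - x) by lra.
  by rewrite rampN; have := ramp_lt_half (x := e N - x) s0; have := ex N (ltnSn N); lra.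
- by rewrite leqnSn leqnn.
- move=> j jN; apply: ramp_ge => //; have := ex N (ltnSn N).
  by have := gap j N; rewrite jN ltnSn => /(_ isT); lra.
- by move=> j /andP[/leq_ltn_trans h /h]; rewrite ltnn.
Qed.

Lemma sum_only k n (a : nat -> R) : (k < n)%N ->
  (forall j, (j < n)%N -> j != k -> a j = 0) -> \sum_(j < n) a j = a k.
Proof.
move=> kn a0; rewrite (bigD1 (Ordinal kn))//= big1 ?addr0// => j jk.
by apply: a0 => //; apply: contra jk => /eqP jk; apply/eqP/val_inj.
Qed.

(** On [[0, 1]], [phi] is [2 * T - 1], where [T] climbs and descends unit steps in turn between
    consecutive jumps. On the k-th gap both [g] and [lambda * (2 f - 1)] are multiples of
    [(-1) ^+ k * contrast], with factors [2 * c k] and [lambda]. *)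
Lemma calibration sigma lambda N e : 0 < sigma -> 0 < lambda -> ~~ odd N ->
  (forall j, (j < N)%N -> 0 <= e j <= 1) ->
  (forall i j, (i < j < N)%N -> sigma <= e j - e i) ->
  (forall k, (k.+1 < N)%N -> 2 / lambda < e k.+1 - e k - 2 / 3 * sigma) ->
  exists phi g : R -> R,
  [/\ forall x, is_derive x 1 phi (g x), continuous g,
      vanishes_outside 4 phi /\ (forall x, `|phi x| <= 1),
      forall j, (j < N)%N -> phi (e j) = - (-1) ^+ j &
      forall x, 0 <= x <= 1 -> (forall j, (j < N)%N -> x != e j) ->
        step_sum N e x = 1 /\ g x < lambda * (2 * blurred sigma N e x - 1) \/
        step_sum N e x = 0 /\ lambda * (2 * blurred sigma N e x - 1) < g x].
Proof.
move=> s0 l0 Neven e01 gap big_gap.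
have einc : increasing_edges N e by move=> i j /gap; lra.
have emono i j : (i <= j < N)%N -> e i <= e j.
  move=> /andP[]; rewrite leq_eqVlt => /predU1P[->//|ij] jN.
  by rewrite ltW// einc// ij.
pose c k := (e k.+1 - e k - 2 / 3 * sigma)^-1.
pose h k x := c k * Num.max 0 (contrast sigma (e k) (e k.+1) x).
have /choice[S hS] : forall k, exists S : R -> R, (k.+1 < N)%N ->
   [/\ forall x, is_derive x 1 S (h k x), forall x, x <= e k -> S x = 0,
       forall x, e k.+1 <= x -> S x = 1 & forall x, 0 <= S x <= 1].
  move=> k; have [kN|kN] := boolP (k.+1 < N)%N; last by exists (cst 0).
  have [|S [S1 S2 S3 S4]] := @contrast_step R sigma (e k) (e k.+1) s0.
    by apply: gap; rewrite ltnSn.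
  by exists S.
have N1 k : (k < N.-1)%N -> (k.+1 < N)%N by lia.
(* [K] is the value of [T] past the last jump: 1 if there are jumps, as [N] is even, and 0 if
   [N = 0]. *)
pose K : R := (odd N.-1)%:R.
pose T x := \sum_(i < N.-1) (-1) ^+ i * S i x.
(* The unit ramps centred at -2 and 3 take [phi] from 0 to -1 before [[0, 1]] and from [2 * K - 1]
   back to 0 after it, whence the radius 4. *)
pose phi x := - ramp 1 (x + 2) + 2 * T x + (1 - 2 * K) * ramp 1 (x - 3).
pose g x := - hat 1 (x + 2) + 2 * (\sum_(i < N.-1) (-1) ^+ i * h i x)
            + (1 - 2 * K) * hat 1 (x - 3).
(* The steps rise on successive intervals, so [S j x > 0] forces [S i x = 1] for [i < j]: at fixed
   [x] they decrease in the index. *)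
have T01 x : 0 <= T x <= 1.
  apply: (alternating_sum_bounds (a := fun i => S i x)) => // [j jN|i j /andP[ij jN]].
    by have [_ _ _] := hS _ (N1 _ jN).
  have [_ Sl _ /(_ x)/andP[_ Sj1]] := hS _ (N1 _ jN).
  have [_ _ Sr /(_ x)/andP[Si0 _]] := hS i (N1 _ (ltn_trans ij jN)).
  have [xe|ex] := leP x (e j); first by rewrite Sl.
  rewrite Sr// (le_trans _ (ltW ex))//.
  by apply: emono; rewrite ij ltnW// N1.
have Tlt x : (forall j, (j < N)%N -> x <= e j) -> T x = 0.
  move=> xe; apply: big1 => i _; have iN := N1 _ (ltn_ord i).
  have [_ Sl _ _] := hS _ iN; rewrite Sl ?mulr0//; apply: xe; lia.
have Tgt x : (forall j, (j < N)%N -> e j <= x) -> T x = K.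
  move=> ex; rewrite /K -sum_sign_odd; apply: eq_bigr => i _.
  have iN := N1 _ (ltn_ord i).
  by have [_ _ Sr _] := hS _ iN; rewrite Sr ?mulr1//; apply: ex.
have Tlt0 x : x <= 0 -> T x = 0.
  by move=> x0; apply: Tlt => j /e01; lra.
have Tgt1 x : 1 <= x -> T x = K.
  by move=> x1; apply: Tgt => j /e01; lra.
have phi_l x : x <= 0 -> phi x = - ramp 1 (x + 2).
  by move=> x0; rewrite /phi Tlt0// (ramp_le (x := x - 3)); lra.
have phi_m x : 0 <= x <= 1 -> phi x = 2 * T x - 1.
  by move=> x0; rewrite /phi ramp_ge; [|lra|lra]; rewrite (ramp_le (x := x - 3)); lra.
have phi_r x : 1 <= x -> phi x = (2 * K - 1) * (1 - ramp 1 (x - 3)).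
  by move=> x1; rewrite /phi Tgt1// (ramp_ge (x := x + 2)); lra.
exists phi, g; split.
- move=> x.
  have dT : is_derive x 1 T (\sum_(i < N.-1) (-1) ^+ i * h i x).
    rewrite (_ : T = \sum_(i < N.-1) (fun y => (-1) ^+ i * S i y)); last first.
      by apply/funext => y; rewrite fct_sumE.
    apply: is_derive_sum => i; have [dS _ _ _] := hS _ (N1 _ (ltn_ord i)).
    exact: (is_deriveZ ((-1) ^+ i : R) (dS x)).
  have d1 : is_derive x 1 (fun y => ramp 1 (y + 2)) (hat 1 (x + 2)).
    by apply: is_derive_comp_shift; exact: is_derive_ramp.
  have d2 : is_derive x 1 (fun y => ramp 1 (y - 3)) (hat 1 (x - 3)).
    by apply: is_derive_comp_shift; exact: is_derive_ramp.
  exact: (is_deriveD (is_deriveD (is_deriveN d1) (is_deriveZ (2 : R) dT))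
    (is_deriveZ (1 - 2 * K) d2)).
- have ch i : continuous (h i).
    move=> x; apply: cvgM; first exact: cvg_cst.
    by apply: continuous_max; [exact: cvg_cst|exact: continuous_contrast].
  move=> x; apply: cvgD; first apply: cvgD.
  + apply: cvgN; rewrite -(opprK 2); exact: continuous_hat_shift.
  + apply: cvgM; first exact: cvg_cst.
    apply: cvg_big => [|i _]; first exact: add_continuous.
    by apply: cvgM; [exact: cvg_cst|exact: ch].
  + by apply: cvgM; [exact: cvg_cst|exact: continuous_hat_shift].
- split=> x; [|].
    rewrite lter_normr => /orP[] hx.
      by rewrite phi_r ?ramp_ge; lra.
    by rewrite phi_l ?ramp_le; lra.
  have [x0|x0] := leP x 0.
    by rewrite phi_l// normrN; have := @ramp_bounds R 1 (x + 2) ltr01; rewrite ler_norml; lra.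
  have [x1|x1] := leP x 1.
    by rewrite phi_m ?(ltW x0)//; have := T01 x; rewrite ler_norml; lra.
  rewrite phi_r; last lra.
  have := @ramp_bounds R 1 (x - 3) ltr01; rewrite /K ler_norml.
  by case: (odd _) => /=; lra.
- move=> j jN; rewrite phi_m ?e01// /T.
  rewrite (@alternating_sum_split _ N.-1 j j (fun i => S i (e j))).
  + rewrite big_geq// addr0 -signr_odd; case: (odd j) => /=; rewrite ?expr0 ?expr1; lra.
  + by lia.
  + move=> i ij; have iN : (i.+1 < N)%N by lia.
    by have [_ _ Sr _] := hS i iN; apply: Sr; apply: emono; rewrite ij.
  + move=> i /andP[ji /N1 iN]; have [_ Sl _ _] := hS i iN; apply: Sl.
    by apply: emono; rewrite ji ltnW.
move=> x x01 xe.
have [m [mN h1 h2]] := locate_edges einc xe.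
have Z : step_sum N e x = (odd m)%:R.
  by apply: step_sum_odd => // j /h2 /ltW.
have gE : g x = 2 * (\sum_(i < N.-1) (-1) ^+ i * h i x).
  rewrite /g !hat_eq0 ?oppr0 ?mulr0 ?add0r ?addr0//.
  - by rewrite ler_normr; apply/orP; right; lra.
  - by rewrite ler_normr; apply/orP; left; lra.
have h0 i : (i < N.-1)%N -> i != m.-1 \/ m = 0%N \/ m = N -> h i x = 0.
  move=> iN im; rewrite /h max_l ?mulr0//; apply: contrast_le0 => //.
  have [mi|mi] := leqP m i; first by left; rewrite ltW// h2//; lia.
  by right; rewrite ltW// h1//; lia.
(* Beyond the outermost jumps [g] is 0 and the blurred signal is below 1/2; between jumps only the
   term of index [m.-1] survives in [g]. *)
have [mout|mout] : (m = 0%N \/ m = N) \/ (0 < m < N)%N by lia.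
  right; rewrite Z; split; first by case: mout => -> //; rewrite (negbTE Neven).
  rewrite gE big1 ?mulr0; last by move=> i _; rewrite h0 ?mulr0//; right.
  rewrite pmulr_rlt0//.
  have : blurred sigma N e x < 1 / 2.
    apply: blurred_outside => //; case: mout => mE; [left|right] => j jN.
      by apply: h2; rewrite mE.
    by apply: h1; rewrite mE.
  lra.
have mE : m = m.-1.+1 by lia.
set k := m.-1 in mE h0.
have kN : (k.+1 < N)%N by lia.
have xk : e k < x < e k.+1 by apply/andP; split; [apply: h1|apply: h2]; lia.
have b0 : 0 < contrast sigma (e k) (e k.+1) x.
  by apply: contrast_gt0 => //; apply: gap; rewrite ltnSn.
rewrite (blurred_between s0 gap kN xk) Z gE.
rewrite (@sum_only k _ (fun i => (-1) ^+ i * h i x)); [|lia|]; last first.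
  by move=> j jN jk; rewrite h0 ?mulr0//; left.
rewrite /h max_r; last exact: ltW.
(* The width condition, rearranged; the positive contrast turns it into the strict sign. *)
have ck : 2 * c k < lambda.
  have := big_gap _ kN; rewrite ltr_pdivrMr// => hk.
  have g0 : 0 < e k.+1 - e k - 2 / 3 * sigma.
    by have := gap k k.+1; rewrite ltnSn kN => /(_ isT); lra.
  by rewrite /c ltr_pdivrMr// mulrC.
rewrite mE -signr_odd /=; move: (contrast _ _ _ _) b0 => b b0.
by case: (odd k) => /=; [right|left]; rewrite ?expr0 ?expr1; split => //; nra.
Qed.

End Calibration.

(** * Part (2): minimality by calibration *)

Section BarCodeMinimiser.
Context {R : realType}.
Local Notation mu := (@lebesgue_measure R).
Implicit Types (sigma lambda x A : R) (N : nat) (e : nat -> R) (F f z u : R -> R).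

Lemma L1_after (a : R) f : L1 f -> L1 (fun x => (a < x)%R%:R * f x).
Proof.
move=> hf; rewrite (_ : (fun _ => _) = (fun x => f x * \1_`]a, +oo[ x)).
  apply: L1M => //; exists 1; apply: aeW => x.
  by rewrite indicE; case: (_ \in _); rewrite ?normr1 ?normr0.
apply/funext => x; rewrite mulrC indicE; congr (_ * (nat_of_bool _)%:R).
by apply/idP/idP; rewrite inE/= in_itv/= andbT.
Qed.

(** Integration by parts over all jumps, used with a ramp to compute the blur and with a test
    function to compute the variation. *)
Lemma Rintegral_step_sum N e z A F f : L1 z ->
  {ae mu, forall x, z x = step_sum N e x} -> continuous f ->
  (forall x, is_derive x 1 F (f x)) -> vanishes_outside A f ->
  (forall j, (j < N)%N -> e j < A) ->
  \int[mu]_x (z x * f x) = \sum_(j < N) (-1) ^+ j * (F A - F (e j)).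
Proof.
move=> hz zE cf dF f0 eA; have hf := compact_support_L1 cf f0.
have [M fM] := compact_support_bounded cf f0.
pose t j x := (-1) ^+ j * ((e j < x)%R%:R * f x).
have ht j : L1 (t j) by apply: L1Z; exact: L1_after.
rewrite (@ae_eq_Rintegral _ _ (fun x => \sum_(j < N) t j x)).
- rewrite Rintegral_sum//; apply: eq_bigr => j _.
  by rewrite RintegralZl//; [rewrite (Rintegral_after cf dF f0)// eA|exact: L1_after].
- apply: L1M => //; first exact: continuous_measurable_fun.
  by exists M; apply: aeW.
- by apply: L1_measurable; apply: L1_sum.
- apply: filterS zE => x ->; rewrite /step_sum mulr_suml.
  by apply: eq_bigr => j _; rewrite /t mulrA.
Qed.

Lemma convolution_hat_step_sum sigma N e z x : 0 < sigma -> L1 z ->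
  {ae mu, forall x, z x = step_sum N e x} -> (forall j, (j < N)%N -> e j <= 1) ->
  convolution (hat sigma) z x = blurred sigma N e x.
Proof.
move=> s0 hz zE e1; rewrite /convolution.
transitivity (\int[mu]_y (z y * hat sigma (x - y))).
  by apply: eq_Rintegral => y _; rewrite mulrC.
(* [A] lies beyond all jumps and beyond the support of the hat centred at [x], where the ramp is
   0. *)
pose A : R := `|x| + sigma + 1.
have Ax : x - A <= - sigma by have := ler_norm x; rewrite /A; lra.
have dF (y : R) : is_derive y 1 (fun y : R => - ramp sigma (x - y)) (hat sigma (x - y)).
  rewrite -[X in is_derive _ _ _ X]opprK; apply: is_deriveN.
  by apply: is_derive_comp_reflect; exact: is_derive_ramp.
have cf : continuous (fun y => hat sigma (x - y)).
  move=> y; apply: (@continuous_comp _ _ _ (fun y => x - y) (hat sigma)).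
    by apply: cvgB; [exact: cvg_cst|exact: cvg_id].
  exact: continuous_hat.
rewrite (Rintegral_step_sum (A := A) hz zE cf dF).
- apply: eq_bigr => j _; congr (_ * _).
  by rewrite (ramp_le s0 Ax) oppr0 sub0r opprK.
- move=> y; rewrite /A => Ay; rewrite hat_eq0//.
  by have := lerB_normD y (- x); rewrite normrN distrC; lra.
- by move=> j /e1; have := normr_ge0 x; rewrite /A; lra.
Qed.

Lemma TV_step_sum N e z : L1 z -> {ae mu, forall x, z x = step_sum N e x} ->
  (TV z <= N%:R%:E)%E.
Proof.
move=> hz zE; apply: ge_ereal_sup => _ [phi tphi <-].
have [A [g [A0 dphi cg phi0]]] := TV_testP tphi.
have phi1 : forall x, `|phi x| <= 1 by case: tphi.
have [_ dE] := is_derive_TV_test dphi cg phi0 phi1.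
(* [B] exceeds the support radius and every jump, so the integral is minus the alternating sum of
   the [phi (e j)], at most [N]. *)
pose B := A + 1 + \sum_(j < N) (`|e j| + 1).
have AB : A < B.
  have : 0 <= \sum_(j < N) (`|e j| + 1) by rewrite sumr_ge0// => j _; rewrite addr_ge0.
  by rewrite /B; lra.
have eB j : (j < N)%N -> e j < B.
  move=> jN; rewrite /B (bigD1 (Ordinal jN))//=.
  have : 0 <= \sum_(i < N | i != Ordinal jN) (`|e i| + 1).
    by rewrite sumr_ge0// => i _; rewrite addr_ge0.
  by have := ler_norm (e j); lra.
have [M gM] := compact_support_bounded cg (derive_vanishes_outside dphi phi0).
have iz : L1 (fun x => z x * g x).
  apply: L1M => //; first exact: continuous_measurable_fun.
  by exists M; apply: aeW.
rewrite dE EFin_Rintegral// lee_fin.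
have gB := vanishes_outsideW (ltW AB) (derive_vanishes_outside dphi phi0).
rewrite (Rintegral_step_sum hz zE cg dphi gB eB).
have -> : N%:R = \sum_(j < N) 1 :> R by rewrite sumr_const card_ord.
apply: ler_sum => j _; have -> : phi B = 0 by rewrite phi0// (lt_le_trans AB)// ler_norm.
rewrite sub0r mulrN (le_trans (ler_norm _))// normrN normrM normrX normrN1 expr1n mul1r.
exact: phi1.
Qed.

Lemma barcode_minimiser omega sigma lambda z : 0 < omega -> 0 < sigma ->
  0 < lambda -> barcode_width omega z -> sigma <= omega ->
  2 / 3 * sigma + 2 / lambda < omega ->
  unique_minimiser (F1 lambda (convolution (hat sigma) z)) barcode z.
Proof.
move=> o0 s0 l0 hz so slo.
have [N [e [Neven e01 gap0 zE]]] := barcode_edges o0 hz.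
have gap := spaced_edges o0 gap0.
have [bz _] := hz; have [[iz Tz] [z01 zout]] := bz.
have ess1 u : barcode u -> ess_bounded u.
  move=> [_ [u01 _]]; exists 1.
  by apply: filterS u01 => x [] ->; rewrite ?normr0 ?normr1.
have ihat : L1 (hat sigma).
  by have := L1_hat_shift 0 s0; under eq_fun do rewrite subr0.
set f := convolution (hat sigma) z.
have i_f : L1 f by apply: L1_convolution => //; exact: ess1.
have bf : ess_bounded f.
  have [M fM] := convolution_bounded ihat iz (ess1 _ bz).
  by exists M; apply: aeW.
have fE x : f x = blurred sigma N e x.
  by apply: convolution_hat_step_sum => // j /e01/andP[].
have gaps i j : (i < j < N)%N -> sigma <= e j - e i by move=> /gap; lra.
have big_gap k : (k.+1 < N)%N -> 2 / lambda < e k.+1 - e k - 2 / 3 * sigma.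
  by move=> /gap0; lra.
have [phi [g [dphi cg [phi0 phi1] phie gsign]]] :=
  calibration s0 l0 Neven e01 gaps big_gap.
have gv := derive_vanishes_outside dphi phi0.
have [M gM] := compact_support_bounded cg gv.
have iug u : L1 u -> L1 (fun x => u x * g x).
  move=> iu; apply: L1M => //; first exact: continuous_measurable_fun.
  by exists M; apply: aeW.
have isq u : barcode u -> L1 (fun x => (u x - f x) ^+ 2).
  move=> bu; have [[iu _] _] := bu; apply: L1_sqr; first exact: L1B.
  by apply: ess_boundedB => //; exact: ess1.
(* By [le_TV] the integral of [E u] bounds the energy of [u] from below, and [E u] can be compared
   with [E z] pointwise. *)
pose E u x := u x * g x + lambda * (u x - f x) ^+ 2.
have iE u : barcode u -> L1 (E u).
  move=> bu; have [[iu _] _] := bu; apply: L1D; first exact: iug.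
  by apply: L1Z; exact: isq.
have IE u : barcode u -> \int[mu]_x E u x =
    \int[mu]_x (u x * g x) + lambda * \int[mu]_x ((u x - f x) ^+ 2).
  move=> bu; have [[iu _] _] := bu.
  rewrite RintegralD//; [|exact: iug|by apply: L1Z; exact: isq].
  by rewrite RintegralZl//; exact: isq.
have lowF u : barcode u -> ((\int[mu]_x E u x)%:E <= F1 lambda f u)%E.
  move=> bu; have [[iu _] _] := bu.
  rewrite F1E//; [|exact: ess1]; rewrite IE// EFinD leeD2r//.
  exact: (le_TV iu dphi cg phi0 phi1).
(* The bound is attained at [z]: the values [phi (e j)] turn the integral of [z * g] into [N], which
   is at least [TV z]. *)
have Fz : F1 lambda f z = (\int[mu]_x E z x)%:E.
  apply/eqP; rewrite eq_le lowF// andbT F1E//; last exact: ess1.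
  rewrite IE// EFinD leeD2r// (le_trans (TV_step_sum iz zE))// lee_fin.
  rewrite (Rintegral_step_sum (A := 4 + 1) iz zE cg dphi).
  - rewrite phi0; last by rewrite gtr0_norm; lra.
    have -> : N%:R = \sum_(j < N) 1 :> R by rewrite sumr_const card_ord.
    apply: ler_sum => j _; rewrite phie// sub0r opprK -signr_odd.
    by case: (odd j); rewrite /= ?expr1 ?expr0; lra.
  - by apply: vanishes_outsideW gv; lra.
  - by move=> j /e01; lra.
have xe : {ae mu, forall x, forall j, x != e j}.
  apply: ae_foralln => i; exists [set e i]; split => //.
    exact: lebesgue_measure_set1.
  by move=> x /= /negP/negPn/eqP.
have ze : {ae mu, forall x, [/\ ~ `[0, 1]%classic x -> z x = 0,
    z x = step_sum N e x & forall j, x != e j]}.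
  by apply: filterS3 zout zE xe => x.
(* Passing from value 0 to value 1 changes [E] by [g - lambda * (2 f - 1)], whose strict sign
   favours the value of [z]; outside [[0, 1]] both functions are 0. *)
have pw u : barcode u ->
   {ae mu, forall x, 0 <= E u x - E z x /\ (E u x - E z x = 0 -> u x = z x)}.
  move=> [_ [u01 uout]].
  apply: filterS3 u01 uout ze => x u01x uoutx [zoutx zEx xex].
  have [x01|x01] := pselect (`[0, 1]%classic x); last first.
    by rewrite /E uoutx// zoutx// subrr.
  have x01' : 0 <= x <= 1 by move: x01; rewrite /= in_itv.
  have := gsign x x01' (fun j _ => xex j).
  rewrite -zEx /E -fE; move: (g x) (f x) => gx fx.
  by case: u01x => ->; case=> -[-> h]; split; nra.
split => //.
  move=> v bv; rewrite Fz (le_trans _ (lowF v bv))// lee_fin.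
  apply: ae_le_Rintegral; [exact: iE|exact: iE|].
  by apply: filterS (pw v bv) => x [+ _]; rewrite subr_ge0.
move=> u bu umin; have := le_trans (lowF u bu) (umin _ bz).
rewrite Fz lee_fin -subr_le0 -RintegralB//; [|exact: iE|exact: iE].
have iw : L1 (fun x => E u x - E z x) by apply: L1B; exact: iE.
have w0 : {ae mu, forall x, 0 <= E u x - E z x} by apply: filterS (pw u bu) => x [].
move=> /(ae_ge0_Rintegral_le0 iw w0) w00.
by apply: filterS2 w00 (pw u bu) => x h [_ k] _; exact: k.
Qed.

End BarCodeMinimiser.

Theorem theorem1p1 (R : realType) (omega sigma lambda : R)
    (omega_gt0 : 0 < omega) (sigma_gt0 : 0 < sigma) (lambda_gt0 : 0 < lambda)
    (z : R -> R) (hz : barcode_width omega z) :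
  (forall phi : R -> R, blur_kernel sigma phi ->
     (unique_minimiser (F1 lambda (convolution phi z)) BV (cst 0) <->
      (dual_norm (convolution phi z) <= (1 / (2 * lambda))%:E)%E))
  /\
  (sigma <= omega -> 2 / 3 * sigma + 2 / lambda < omega ->
   unique_minimiser (F1 lambda (convolution (hat sigma) z)) barcode z).
Proof.
have [[[iz _] [z01 _]] _] := hz.
have bz : ess_bounded z.
  by exists 1; apply: filterS z01 => x [] ->; rewrite ?normr0 ?normr1.
split; last exact: barcode_minimiser omega_gt0 sigma_gt0 lambda_gt0 hz.
move=> phi [iphi _]; apply: unique_minimiser_cst0 => //.
  exact: L1_convolution.
have [M fM] := convolution_bounded iphi iz bz.
by exists M; apply: aeW.
Qed.
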